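(* Let $P\subset\mathbb R^n$ be an $n$-dimensional convex polytope that is monotypic but not strongly monotypic. Then $P$ does not have the generating property.
   Context: For a polytope $P\subset\mathbb R^n$, $N(P)$ denotes the set of outward unit normal vectors of the facets of $P$. $P$ is monotypic if every polytope $Q$ with $N(Q)=N(P)$ is combinatorially equivalent to $P$. $P$ is strongly monotypic if every polytope $Q$ with $N(Q)=N(P)$ has the property that the arrangement of the hyperplanes spanned by the facets of $Q$ is combinatorially equivalent to the arrangement of the hyperplanes spanned by the facets of $P$. $P$ has the generating property if the intersection of every family of translates of $P$ is either empty or a Minkowski summand of $P$ (a set $A$ such that $A+B=P$ for some set $B$, where $A+B=\{a+b:a\in A,b\in B\}$). *)

(* Defs.v *)
From mathcomp Require Import all_boot all_order all_algebra.
From mathcomp Require Import boolp classical_sets functions cardinality.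
From mathcomp Require Import interval_inference reals topology normedtype convex.

Set Implicit Arguments.
Unset Strict Implicit.
Unset Printing Implicit Defensive.

Import Order.TTheory GRing.Theory Num.Theory.
Import numFieldNormedType.Exports.

Local Open Scope classical_set_scope.
Local Open Scope ring_scope.

(* Two families of sets that are isomorphic as posets ordered by inclusion.   *)
Definition inclusion_isomorphic (T U : Type)
    (F : set (set T)) (G : set (set U)) : Prop :=
  exists2 phi : set T -> set U,
    set_bij F G phi &
    forall A B, F A -> F B -> (A `<=` B <-> phi A `<=` phi B).

Section Polytopes.
Variables (R : realType) (n : nat).
Local Notation V := 'rV[R]_n.
Implicit Types (A B P Q F H : set V) (u x y t : V).

(* The norm that the library puts on 'rV[R]_n is the sup norm, so Euclidean   *)
(* unit vectors are those with dot u u = 1.                                   *)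
Definition dot u x : R := \sum_i u 0 i * x 0 i.

Definition conv_hull A : set V := smallest (@convex_set R V) A.

Definition aff_hull A : set V :=
  [set x | exists (k : nat) (v : 'I_k -> V) (w : 'I_k -> R),
     [/\ forall i, A (v i), \sum_i w i = 1 & x = \sum_i w i *: v i]].

(* The empty set has no dimension.                                            *)
Definition has_dim A (d : nat) : Prop :=
  exists (x : V) (W : {vspace V}),
    \dim W = d /\ aff_hull A = [set y | y - x \in W].

Definition polytope P : Prop :=
  exists S : set V, [/\ finite_set S, S !=set0 & P = conv_hull S].

Definition is_face_cut P u (c : R) F : Prop :=
  (forall x, P x -> dot u x <= c) /\ F = P `&` [set x | dot u x = c].

(* Taking u = 0 yields the improper faces set0 (c = 1) and P (c = 0).         *)
Definition faces P : set (set V) :=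
  [set F | exists u c, is_face_cut P u c F].

Definition facets P : set (set V) :=
  [set F | faces P F /\ exists d, has_dim P d.+1 /\ has_dim F d].

Definition facet_normals P : set V :=
  [set u | dot u u = 1 /\ exists c F, facets P F /\ is_face_cut P u c F].

Definition monotypic P : Prop :=
  forall Q, polytope Q -> facet_normals Q = facet_normals P ->
    inclusion_isomorphic (faces Q) (faces P).

Definition facet_hyperplanes P : set (set V) := aff_hull @` facets P.

(* For a hyperplane H: both points lie on H, or both lie in the same open     *)
(* half-space bounded by H (the segment [x, y] misses H).                     *)
Definition same_position H x y : Prop :=
  (H x /\ H y) \/
  (forall s : R, 0 <= s <= 1 -> ~ H ((1 - s) *: x + s *: y)).

(* The closed cells, of all dimensions, of the arrangement of a family of     *)
(* hyperplanes; each is the closure of a class of points having the same      *)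
(* position with respect to every hyperplane.                                 *)
Definition arrangement_cells (HH : set (set V)) : set (set V) :=
  [set closure [set y | forall H, HH H -> same_position H x y] | x in setT].

Definition strongly_monotypic P : Prop :=
  forall Q, polytope Q -> facet_normals Q = facet_normals P ->
    inclusion_isomorphic (arrangement_cells (facet_hyperplanes Q))
                         (arrangement_cells (facet_hyperplanes P)).

Definition minkowski_sum A B : set V := [set a + b | a in A & b in B].

Definition minkowski_summand A P : Prop :=
  exists B, minkowski_sum A B = P.

Definition translate P t : set V := [set x + t | x in P].

(* A family of translates is given by its set T of translation vectors, and   *)
(* is nonempty: the empty family would intersect to the whole space.          *)
Definition generating_property P : Prop :=
  forall T : set V, T !=set0 ->
    let A := \bigcap_(t in T) translate P t in
    A = set0 \/ minkowski_summand A P.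

End Polytopes.

(* Main.v *)
(* Let u_i be the unit facet normals of P = {x | u_i x <= h_i}. If P has the  *)
(* generating property, then every nonempty polytope {x | u_i x <= h'_i} with *)
(* h' close to 0 is an intersection of translates of P, hence a summand of P; *)
(* so its normal fan is refined by that of P. In particular every independent *)
(* set of normals whose positive hull contains no further normal spans a cone *)
(* of the fan of P.                                                           *)
(*   Suppose that a circuit sum_A l_a u_a = sum_B m_b u_b (l, m > 0) of the   *)
(* normals has |A|, |B| >= 2. Both positive hulls are unions of cones of the  *)
(* fan, so the common value is a multiple of some normal u_k. For minimal A   *)
(* and B the facet k looks like a product of two simplices: just below it     *)
(* there are points p_ab of P, all at the same height with respect to u_k,    *)
(* such that p_ab lies on the facets in A \ a and B \ b and p_ab - p_ab' does *)
(* not depend on a. Let X be the set of x such that x + p_ab0 is in P for all *)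
(* a, an intersection of translates of P. As |A|, |B| >= 2, u_k <= 0 on X and *)
(* if X + Y is contained in P then u_k is on Y at most the height of the      *)
(* points p_ab; so X + Y misses the facet k, and X is not a summand of P.     *)
(*   Hence every circuit c of the normals has at most one positive or at most *)
(* one negative coefficient, and then the sign of sum_i c_i h_i is the same   *)
(* for all polytopes {x | u_i x <= h_i} having all the u_i as facet normals.  *)
(* By Farkas' lemma these signs determine which sign vectors occur in the     *)
(* arrangement of the facet hyperplanes, so P is strongly monotypic.          *)
Require Import Defs.
From mathcomp Require Import all_boot all_order all_algebra.
From mathcomp Require Import boolp classical_sets functions cardinality reals.
From mathcomp Require Import interval_inference topology normedtype convex.
From mathcomp Require Import ring lra.

Set Implicit Arguments.
Unset Strict Implicit.
Unset Printing Implicit Defensive.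

Import Order.TTheory GRing.Theory Num.Theory.
Import numFieldNormedType.Exports.
Local Open Scope ring_scope.

(** The outline above splits at [no_bad_circuit]. Before it, the generating property enters only
    through [generating_translates], twice. In [local_cone_summand] it makes truncated cones
    summands of P; [facial_comb] and [primitive_facial] turn this into statements about the normal
    fan. In [no_bad_circuit] it is applied to the set X built on the points of [exists_grid], which
    rest on [minimal_center] and [link_facial]. After it, only the absence of bad circuits matters,
    and this concerns the normals alone. [circuit_sum_gt0] fixes the sign of each remaining circuit,
    [no_certificate] excludes Farkas certificates, [same_signs] carries sign vectors from one
    right-hand side to another, and [cells_isomorphic] reads the poset of cells off the sign
    vectors. *)

(** * Farkas' lemma for linear forms *)

Section Farkas.
Variables (R : realFieldType) (E : lmodType R).
Implicit Types (g : E -> R).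

Definition functional g := forall a x y, g (a *: x + y) = a * g x + g y.

Lemma functionalD g x y : functional g -> g (x + y) = g x + g y.
Proof. by move=> gl; rewrite -{1}[x]scale1r gl mul1r. Qed.

Lemma functional0 g : functional g -> g 0 = 0.
Proof.
move=> gl; have := functionalD 0 0 gl.
by rewrite addr0 => /eqP; rewrite -subr_eq0 opprD addNKr oppr_eq0 => /eqP.
Qed.

Lemma functionalZ g a x : functional g -> g (a *: x) = a * g x.
Proof. by move=> gl; rewrite -[a *: x]addr0 gl (functional0 gl) addr0. Qed.

(** Induction on the constraints. If the last one, k, matters, some x0 satisfies the others and has
    g x0 > 0, so f k x0 > 0; projecting along x0 onto the kernel of f k eliminates k. *)
Lemma farkas (I : eqType) (s : seq I) (f : I -> E -> R) (g : E -> R) :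
    uniq s -> (forall i, functional (f i)) -> functional g ->
    (forall x, (forall i, i \in s -> f i x <= 0) -> g x <= 0) ->
  exists2 l : I -> R, forall i, 0 <= l i &
    forall x, g x = \sum_(i <- s) l i * f i x.
Proof.
elim: s f g => [|k s IHs] f g.
  move=> _ _ gl gle; exists (fun=> 0) => // x; rewrite big_nil.
  apply/eqP; rewrite eq_le gle //=.
  by have := gle ((-1) *: x); rewrite functionalZ // mulN1r oppr_le0; exact.
move=> /= /andP[kNs us] fl gl gle.
have [H|] := pselect (forall x, (forall i, i \in s -> f i x <= 0) -> g x <= 0).
  have [l l0 gE] := IHs f g us fl gl H.
  exists (fun i => if i == k then 0 else l i) => [i|x]; first by case: ifP.
  rewrite big_cons eqxx mul0r add0r gE; apply: eq_big_seq => i si.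
  by case: eqP => // ik; rewrite -ik si in kNs.
move=> /existsNP[x0 /not_implyP[fx0 /negP]]; rewrite -ltNge => gx0.
have fkx0 : 0 < f k x0.
  rewrite ltNge; apply/negP => fkx0; move: gx0; apply/negP; rewrite -leNgt.
  by apply: gle => i; rewrite inE => /orP[/eqP ->|/fx0].
pose p x := x - (f k x / f k x0) *: x0.
have pE h x : functional h -> h (p x) = h x - f k x / f k x0 * h x0.
  by move=> hl; rewrite /p addrC -scaleNr hl mulNr addrC.
have [|i a x y|a x y|x fx|l l0 gE] := IHs (fun i x => f i (p x)) (fun x =>
  g (p x)).
- exact: us.
- by rewrite !pE // !fl; field; apply: lt0r_neq0.
- by rewrite !pE // fl gl; field; apply: lt0r_neq0.
- apply: gle => i; rewrite inE => /orP[/eqP ->|/fx //].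
  by rewrite pE // divfK ?subrr // lt0r_neq0.
(* The coefficient of f k is forced by evaluating the identity at x0; it is nonnegative because f i
   x0 <= 0 for i in s. *)
pose lk := (g x0 - \sum_(i <- s) l i * f i x0) / f k x0.
have lk0 : 0 <= lk.
  apply: divr_ge0; last exact: ltW.
  rewrite subr_ge0 (le_trans _ (ltW gx0)) // big_seq sumr_le0 // => i si.
  by rewrite mulr_ge0_le0 // fx0.
exists (fun i => if i == k then lk else l i) => [i|x]; first by case: ifP.
rewrite big_cons eqxx.
have -> : \sum_(j <- s) (if j == k then lk else l j) * f j x
        = \sum_(j <- s) l j * f j x.
  by apply: eq_big_seq => i si; case: eqP => // ik; rewrite -ik si in kNs.
have := gE x; rewrite pE // => /eqP; rewrite subr_eq => /eqP ->.
rewrite (eq_bigr (fun i => l i * f i x - f k x / f k x0 * (l i * f i x0)));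
  last first.
  by move=> i _; rewrite pE //; ring.
rewrite sumrB -mulr_sumr /lk; field; exact: lt0r_neq0.
Qed.

Lemma farkas_set (I : finType) (S : {set I}) (f : I -> E -> R) (g : E -> R) :
    (forall i, functional (f i)) -> functional g ->
    (forall x, (forall i, i \in S -> f i x <= 0) -> g x <= 0) ->
  exists l : I -> R, [/\ forall i, 0 <= l i, forall i, i \notin S -> l i = 0 &
    forall x, g x = \sum_i l i * f i x].
Proof.
move=> fl gl gle.
have [|l l0 gE] := farkas (enum_uniq (mem S)) fl gl.
  by move=> x fx; apply: gle => i iS; apply: fx; rewrite mem_enum.
exists (fun i => if i \in S then l i else 0); split => [i|i /negPf->|x] //.
  by case: ifP.
rewrite gE big_enum /= big_mkcond /=; apply: eq_bigr => i _.
by case: ifP; rewrite ?mul0r.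
Qed.

End Farkas.

(** * The Euclidean inner product *)

Section Dot.
Variables (R : realType) (n : nat).
Implicit Types (x y z : 'rV[R]_n).

Lemma dotC x y : dot x y = dot y x.
Proof. by apply: eq_bigr => i _; rewrite mulrC. Qed.

Lemma dotDr x y z : dot x (y + z) = dot x y + dot x z.
Proof. by rewrite -big_split; apply: eq_bigr => i _; rewrite mxE mulrDr. Qed.

Lemma dotZr a x y : dot x (a *: y) = a * dot x y.
Proof. by rewrite mulr_sumr; apply: eq_bigr => i _; rewrite mxE mulrCA. Qed.

Lemma dotNr x y : dot x (- y) = - dot x y.
Proof. by rewrite -scaleN1r dotZr mulN1r. Qed.

Lemma dot0r x : dot x 0 = 0.
Proof. by rewrite -(scale0r 0) dotZr mul0r. Qed.

Lemma dotBr x y z : dot x (y - z) = dot x y - dot x z.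
Proof. by rewrite dotDr dotNr. Qed.

Lemma dotDl x y z : dot (x + y) z = dot x z + dot y z.
Proof. by rewrite dotC dotDr !(dotC z). Qed.

Lemma dotZl a x y : dot (a *: x) y = a * dot x y.
Proof. by rewrite dotC dotZr dotC. Qed.

Lemma dotNl x y : dot (- x) y = - dot x y.
Proof. by rewrite dotC dotNr dotC. Qed.

Lemma dot0l x : dot 0 x = 0.
Proof. by rewrite dotC dot0r. Qed.

Lemma dotBl x y z : dot (x - y) z = dot x z - dot y z.
Proof. by rewrite dotDl dotNl. Qed.

Lemma dot_sumr (I : Type) (r : seq I) (P : pred I) (F : I -> 'rV[R]_n) x :
  dot x (\sum_(i <- r | P i) F i) = \sum_(i <- r | P i) dot x (F i).
Proof. exact: (big_morph _ (dotDr x) (dot0r x)). Qed.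

Lemma dot_suml (I : Type) (r : seq I) (P : pred I) (F : I -> 'rV[R]_n) x :
  dot (\sum_(i <- r | P i) F i) x = \sum_(i <- r | P i) dot (F i) x.
Proof. by rewrite dotC dot_sumr; apply: eq_bigr => i _; rewrite dotC. Qed.

Lemma dot_ge0 x : 0 <= dot x x.
Proof. by apply: sumr_ge0 => i _; rewrite -expr2 sqr_ge0. Qed.

Lemma dot_eq0 x : (dot x x == 0) = (x == 0).
Proof.
apply/eqP/eqP => [xx0|->]; last exact: dot0r.
apply/rowP => i; rewrite mxE; apply/eqP; rewrite -sqrf_eq0 expr2.
move/eqP: xx0; rewrite psumr_eq0 => [/allP/(_ i)|j _];
  last by rewrite -expr2 sqr_ge0.
by rewrite mem_index_enum => /(_ isT).
Qed.

Lemma dot_gt0 x : x != 0 -> 0 < dot x x.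
Proof. by rewrite lt_def dot_eq0 dot_ge0 andbT. Qed.

Lemma eq_dot x y : (forall z, dot x z = dot y z) -> x = y.
Proof.
by move=> xy; apply/eqP; rewrite -subr_eq0 -dot_eq0 dotBl xy subrr eqxx.
Qed.

Lemma dot_functional x : functional (dot x).
Proof. by move=> a y z; rewrite dotDr dotZr. Qed.

End Dot.

Lemma exists_lb_gt0 (R : realFieldType) (I : finType) (P : pred I)
    (F : I -> R) :
  (forall i, P i -> 0 < F i) -> exists2 e, 0 < e & forall i, P i -> e <= F i.
Proof.
move=> F0; have [i0 Pi0|P0] := pickP P; last first.
  by exists 1 => // i; rewrite P0.
case: (Order.TotalTheory.arg_minP F Pi0) => i Pi iP.
by exists (F i); [exact: F0|exact: iP].
Qed.

(** * Facet systems and the generating property *)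

Section FacetSystem.
Variables (R : realType) (n : nat) (I : finType).
Local Notation V := 'rV[R]_n.

(** An irredundant description of P by unit normals, one index per facet. [fs_facet] provides
    relative interior points of the facets, and [fs_max] stands for compactness. *)
Record facet_system (P : set V) (u : I -> V) (h : I -> R) : Prop :=
  FacetSystem {
  fs_mem : forall x, P x <-> forall i, dot (u i) x <= h i;
  fs_unit : forall i, dot (u i) (u i) = 1;
  fs_interior : exists x, forall i, dot (u i) x < h i;
  fs_facet : forall i, exists2 x, dot (u i) x = h i &
               forall j, j != i -> dot (u j) x < h j;
  fs_max : forall w, exists2 x, P x & forall y, P y -> dot w y <= dot w x
}.

(** The set is the intersection of the translates of P by the vectors - y j. The index j0 makes the
    family nonempty, and x0 makes the intersection nonempty. *)
Lemma generating_translates (P : set V) (J : Type) (y : J -> V) (j0 : J)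
    (x0 : V) :
    generating_property P -> (forall j, P (x0 + y j)) ->
  minkowski_summand [set x | forall j, P (x + y j)]%classic P.
Proof.
move=> genP Px0.
have E : (\bigcap_(t in [set - y j | j in [set: J]]) translate P t)%classic
       = [set x | forall j, P (x + y j)]%classic.
  apply/seteqP; split=> x /= Px => [j|t [j _ <-]].
    by have [z Pz <-] := Px _ (ex_intro2 _ _ j Logic.I erefl); rewrite subrK.
  by exists (x + y j); [exact: Px|rewrite addrK].
have [||] := genP [set - y j | j in [set: J]]%classic.
- by exists (- y j0), j0.
- by rewrite E => /seteqP[/(_ x0)]; case.
- by rewrite E.
Qed.

End FacetSystem.

Section Core.
Variables (R : realType) (n : nat) (I : finType).
Local Notation V := 'rV[R]_n.
Variables (P : set V) (u : I -> V) (h : I -> R).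
Implicit Types (c d : I -> R) (S A B C D E : {set I}) (x y w : V).

Definition comb c : V := \sum_i c i *: u i.

Definition supported c S := forall i, i \notin S -> c i = 0.

Definition in_pos S y :=
  exists a, [/\ forall i, 0 <= a i, supported a S & y = comb a].

Definition indep S :=
  forall d, supported d S -> comb d = 0 -> forall i, d i = 0.

(** Equivalently, the normals in S lie in a common cone of the normal fan of P. *)
Definition facial S := exists2 x, P x & forall i, i \in S -> dot (u i) x = h i.

Definition indic (k : I) : I -> R := fun i => (i == k)%:R.

Lemma indic_id k : indic k k = 1.
Proof. by rewrite /indic eqxx. Qed.

Lemma indic_neq k i : i != k -> indic k i = 0.
Proof. by rewrite /indic => /negPf ->. Qed.

Lemma indic_ge0 k i : 0 <= indic k i.
Proof. exact: ler0n. Qed.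

Lemma combD c d : comb (fun i => c i + d i) = comb c + comb d.
Proof.
by rewrite /comb -big_split; apply: eq_bigr => i _; rewrite scalerDl.
Qed.

Lemma combZ s c : comb (fun i => s * c i) = s *: comb c.
Proof.
by rewrite /comb scaler_sumr; apply: eq_bigr => i _; rewrite scalerA.
Qed.

Lemma combN c : comb (fun i => - c i) = - comb c.
Proof. by rewrite /comb -sumrN; apply: eq_bigr => i _; rewrite scaleNr. Qed.

Lemma combB c d : comb (fun i => c i - d i) = comb c - comb d.
Proof. by rewrite (combD c (fun i => - d i)) combN. Qed.

Lemma comb_indic k : comb (indic k) = u k.
Proof.
rewrite /comb (bigD1 k) //= indic_id scale1r big1 ?addr0 // => i /indic_neq ->.
by rewrite scale0r.
Qed.

Lemma eq_comb c d : c =1 d -> comb c = comb d.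
Proof. by move=> ab; apply: eq_bigr => i _; rewrite ab. Qed.

Lemma dot_comb c x : dot (comb c) x = \sum_i c i * dot (u i) x.
Proof. by rewrite dot_suml; apply: eq_bigr => i _; rewrite dotZl. Qed.

Lemma facialS S D : S \subset D -> facial D -> facial S.
Proof.
by move=> /fintype.subsetP SD [x Px xD]; exists x => // i /SD; exact: xD.
Qed.

Hypothesis fsP : facet_system P u h.
Hypothesis genP : generating_property P.

Lemma P_le x i : P x -> dot (u i) x <= h i.
Proof. by move=> /(fs_mem fsP); exact. Qed.

Lemma facial1 k : facial [set k].
Proof.
have [x xk xh] := fs_facet fsP k; exists x => [|i];
  last by rewrite inE => /eqP ->.
by apply/(fs_mem fsP) => i; have [->|/xh/ltW//] := eqVneq i k; rewrite xk.
Qed.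

(* The set is the intersection of the translates of P by the h'_i u_i - x_i,  *)
(* where x_i is a relative interior point of the i-th facet and h'_i is the   *)
(* right-hand side of the i-th inequality.                                    *)
Lemma local_cone_summand (i0 : I) S : exists2 rho, 0 < rho &
  minkowski_summand
    [set x | forall i, dot (u i) x <= if i \in S then 0 else rho]%classic P.
Proof.
have [z zE zlt] : exists2 z : I -> V, forall i, dot (u i) (z i) = h i &
    forall i j, j != i -> dot (u j) (z i) < h j.
  have /choice[z zP] : forall i, exists z, dot (u i) z = h i /\
      forall j, j != i -> dot (u j) z < h j.
    by move=> i; have [z ? ?] := fs_facet fsP i; exists z.
  by exists z => i; have [] := zP i.
have [rho rho0 rhoP] : exists2 rho, 0 < rho & forall p : I * I, p.2 != p.1 ->
    rho <= (h p.2 - dot (u p.2) (z p.1)) / (1 + `|dot (u p.2) (u p.1)|).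
  apply: exists_lb_gt0 => -[i j] /= /zlt; rewrite -subr_gt0 => hlt.
  by rewrite divr_gt0 // ltr_pwDl.
exists rho => //; pose h' i : R := if i \in S then 0 else rho.
have h'0 i : 0 <= h' i by rewrite /h'; case: ifP => // _; exact: ltW.
have h'rho i : h' i <= rho by rewrite /h'; case: ifP => // _; exact: ltW.
have yE i : dot (u i) (z i - h' i *: u i) = h i - h' i.
  by rewrite dotBr dotZr zE (fs_unit fsP) mulr1.
have yle i j : dot (u j) (z i - h' i *: u i) <= h j - h' j.
  have [->|ji] := eqVneq j i; first by rewrite yE.
  have := rhoP (i, j) ji; rewrite /= ler_pdivlMr ?ltr_pwDl // => H.
  rewrite dotBr dotZr; set d := dot (u j) (u i) in H *.
  have Hd : - (h' i * d) <= rho * `|d|.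
    by rewrite -mulrN (le_trans (ler_wpM2l (h'0 i) (ler_norm _)))
      // normrN ler_wpM2r.
  by move: (h'rho j) => H1; lra.
have := @generating_translates _ _ P I (fun i => z i - h' i *: u i) i0 0 genP.
have -> : [set x | forall j, P (x + (z j - h' j *: u j))]%classic
        = [set x | forall i, dot (u i) x <= h' i]%classic.
  apply/seteqP; split=> x /= xP i.
    by have := P_le i (xP i); rewrite dotDr yE; lra.
  by apply/(fs_mem fsP) => j; rewrite dotDr; move: (yle i j) (xP j); lra.
apply => j; rewrite add0r; apply/(fs_mem fsP) => i.
by move: (yle j i) (h'0 i); lra.
Qed.

(** Near 0 the truncated cone agrees with the cone u_S <= 0, so by scaling the hypothesis holds on
    the whole cone, and Farkas' lemma applies. *)
Lemma in_posP S k rho : 0 < rho ->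
    (forall x, (forall i, dot (u i) x <= if i \in S then 0 else rho) ->
       dot (u k) x <= 0) ->
  in_pos S (u k).
Proof.
move=> rho0 H.
have [||x xS|a [a0 aS aE]] :=
  @farkas_set R V I S (fun i => dot (u i)) (dot (u k)).
- by move=> i; exact: dot_functional.
- exact: dot_functional.
- have [e e0 eP] := @exists_lb_gt0 R I (fun i => 0 < dot (u i) x)
    (fun i => rho / dot (u i) x) (fun i xi => divr_gt0 rho0 xi).
  have := H (e *: x); rewrite dotZr pmulr_rle0 //; apply=> i.
  rewrite dotZr; case: ifP => [/xS|_]; first by rewrite pmulr_rle0.
  have [xi|xi] := ltrP 0 (dot (u i) x); first by rewrite -ler_pdivlMr // eP.
  by rewrite (le_trans _ (ltW rho0)) // pmulr_rle0.
- by exists a; split=> //; apply: eq_dot => z; rewrite dot_comb aE.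
Qed.

(* P = Q + Q' where Q is the cone [u_S <= 0] near 0; a point of Q' at which   *)
(* comb mu is maximal on P lies on all the facets in the support of mu.       *)
Lemma facial_comb S nu mu D :
    (forall i, 0 <= nu i) -> supported nu S ->
    (forall i, 0 <= mu i) -> supported mu D -> facial D ->
    comb nu = comb mu ->
  forall j, mu j != 0 -> in_pos S (u j).
Proof.
move=> nu0 nuS mu0 muD [p Pp pD] numu j muj.
have [rho rho0 [Q' PE]] := local_cone_summand j S.
have [x xQ [q Qq pE]] : minkowski_sum [set x | forall i : I, dot (u i)
  x <= (if i \in S then 0 else rho)]%classic Q' p.
  by rewrite PE.
have sumP y : (forall i, dot (u i) y <= if i \in S then 0 else rho) ->
  P (y + q).
  by move=> yQ; rewrite -PE; exists y => //; exists q.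
have Pq : P q.
  by rewrite -[q]add0r; apply: sumP => i; rewrite dot0r; case: ifP => // _;
    exact: ltW.
have xle : dot (comb nu) x <= 0.
  rewrite dot_comb sumr_le0 // => i _; have := xQ i;
    case: ifP => [_|/negbT/nuS ->].
    by apply: mulr_ge0_le0.
  by rewrite mul0r.
have qj : dot (u j) q = h j.
  have hq i : 0 <= mu i * (h i - dot (u i) q) by rewrite mulr_ge0 // subr_ge0
    P_le.
  have : \sum_i mu i * (h i - dot (u i) q) <= 0.
    rewrite (eq_bigr (fun i => mu i * dot (u i) p - mu i * dot (u i) q));
      last first.
      move=> i _; rewrite -mulrBr; have [/pD <- //|/muD ->] := boolP (i \in D).
      by rewrite !mul0r.
    by rewrite sumrB -!dot_comb -pE dotDr addrK -numu.
  rewrite le_eqVlt ltNge sumr_ge0 // orbF psumr_eq0 // => /allP/(_ j).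
  rewrite mem_index_enum => /(_ isT); rewrite mulf_eq0 (negPf muj) /=.
  by rewrite subr_eq0 => /eqP <-.
apply: (in_posP rho0) => y /sumP/P_le => /(_ j).
by rewrite dotDr qj gerDr.
Qed.

(** Write P = Q + Q' with Q the truncated cone of S. The Q'-component q of a point on the facets in
    S still lies on them, and q + Q is contained in P; so a small step along x from q stays in P,
    even if q lies on further facets. *)
Lemma facial_off S k x : facial S -> (forall i, i \in S -> dot (u i) x = 0) ->
    dot (u k) x < 0 ->
  exists p, [/\ P p, forall i, i \in S -> dot (u i) p = h i & dot (u k)
    p < h k].
Proof.
move=> [p Pp pS] xS xk.
have [rho rho0 [Q' PE]] := local_cone_summand k S.
have [y yQ [q Qq pE]] : minkowski_sum [set x | forall i : I, dot (u i)
  x <= (if i \in S then 0 else rho)]%classic Q' p.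
  by rewrite PE.
have sumP z : (forall i, dot (u i) z <= if i \in S then 0 else rho) ->
  P (z + q).
  by move=> zQ; rewrite -PE; exists z => //; exists q.
have Pq : P q.
  by rewrite -[q]add0r; apply: sumP => i; rewrite dot0r; case: ifP => // _;
    exact: ltW.
have qS i : i \in S -> dot (u i) q = h i.
  move=> iS; apply/eqP; rewrite eq_le P_le //=; have := yQ i; rewrite iS.
  by rewrite -(pS i iS) -pE dotDr gerDr.
have [e e0 eP] := @exists_lb_gt0 R I (fun i => 0 < dot (u i) x)
  (fun i => rho / dot (u i) x) (fun i xi => divr_gt0 rho0 xi).
exists (e *: x + q); split=> [|i iS|].
- apply: sumP => i; rewrite dotZr; case: ifP => [/xS ->|_];
    first by rewrite mulr0.
  have [xi|xi] := ltrP 0 (dot (u i) x); first by rewrite -ler_pdivlMr // eP.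
  by rewrite (le_trans _ (ltW rho0)) // pmulr_rle0.
- by rewrite dotDr dotZr xS // mulr0 add0r qS.
- have := P_le k Pq; rewrite dotDr dotZr; have : e * dot (u k)
    x < 0 by rewrite pmulr_rlt0.
  lra.
Qed.

(** Were m outside D, comparing the expansion of u_m at a common point of the facets in D and at a
    relative interior point z of facet m would make every facet with a positive coefficient contain
    z. Only facet m does, and its coefficient is 0. *)
Lemma facial_in_pos D m : facial D -> in_pos D (u m) -> m \in D.
Proof.
move=> [x Px xD] [a [a0 aD mE]]; apply/negPn/negP => mD.
have [z zm zlt] := fs_facet fsP m.
have xm := P_le m Px; have am : a m = 0 by exact: aD.
have le1 : h m <= \sum_i a i * h i.
  rewrite -zm mE dot_comb ler_sum // => i _; rewrite ler_wpM2l //.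
  by have [->|/zlt/ltW //] := eqVneq i m; rewrite zm.
have hx : dot (u m) x = \sum_i a i * h i.
  rewrite mE dot_comb; apply: eq_bigr => i _.
  by have [/xD ->|/aD ->] := boolP (i \in D); rewrite ?mul0r.
have : \sum_i a i * (h i - dot (u i) z) == 0.
  rewrite (eq_bigr (fun i => a i * h i - a i * dot (u i) z)); last first.
    by move=> i _; rewrite mulrBr.
  by rewrite sumrB -dot_comb -mE zm subr_eq0 -hx eq_le xm hx le1.
rewrite psumr_eq0 => [/allP az|i _]; last first.
  by rewrite mulr_ge0 // subr_ge0; have [->|/zlt/ltW //] := eqVneq i m;
    rewrite zm.
have a_eq0 i : a i = 0.
  have [->//|im] := eqVneq i m; have := az i; rewrite mem_index_enum =>
    /(_ isT).
  by rewrite mulf_eq0 => /orP[/eqP //|]; rewrite subr_eq0 gt_eqF ?zlt.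
have := fs_unit fsP m; rewrite {1}mE dot_comb big1 => [|i _];
  last by rewrite a_eq0 mul0r.
by move/esym/eqP; rewrite oner_eq0.
Qed.

(** A form maximal at x lies in the normal cone at x: by Farkas' lemma, since every direction that
    respects the tight constraints can be followed a little inside P. *)
Lemma max_in_pos w : exists2 x, P x &
  in_pos [set i | dot (u i) x == h i] w.
Proof.
have [x Px xmax] := fs_max fsP w; exists x => //.
have [||d dS|a [a0 aS aE]] := @farkas_set R V I [set i | dot (u i) x == h i]
  (fun i => dot (u i)) (dot w).
- by move=> i; exact: dot_functional.
- exact: dot_functional.
- have [|e e0 eP] := @exists_lb_gt0 R I (fun i => 0 < dot (u i) d)
    (fun i => (h i - dot (u i) x) / dot (u i) d).
    move=> i di; rewrite divr_gt0 // subr_gt0 lt_neqAle P_le // andbT.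
    by apply: contraTN di => xi; rewrite -leNgt dS // inE.
  have := xmax (x + e *: d); rewrite dotDr dotZr gerDl pmulr_rle0 //; apply.
  apply/(fs_mem fsP) => i; rewrite dotDr dotZr -lerBrDl.
  have [di|di] := ltrP 0 (dot (u i) d); first by rewrite -ler_pdivlMr // eP.
  by rewrite (le_trans (y := 0)) ?pmulr_rle0 // subr_ge0 P_le.
- by exists a; split=> //; apply: eq_dot => z; rewrite dot_comb aE.
Qed.

(** Maximize the sum of the u_i, i in S, and expand it in the normals tight at the maximizer. By
    [facial_comb] and primitivity only normals of S occur, so by independence all of S occurs, and
    all of S is tight. *)
Lemma primitive_facial S : indep S -> (forall m, in_pos S (u m) -> m \in S) ->
  facial S.
Proof.
move=> indS primS.
pose s i : R := (i \in S)%:R.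
have [x Px [a [a0 aT sa]]] := max_in_pos (comb s).
have sS : supported s S by move=> i /negPf; rewrite /s => ->.
have s0 i : 0 <= s i by rewrite /s ler0n.
have aS i : a i != 0 -> i \in S.
  move=> ai; apply: primS; apply: (facial_comb s0 sS a0 aT _ sa ai).
  by exists x => // j; rewrite inE => /eqP.
have /indS asE : supported (fun i => s i - a i) S.
  by move=> i iS; rewrite sS // (contraNeq (aS i) iS) subr0.
exists x => // i iS; have : i \in [set i | dot (u i) x == h i].
  apply: contraT => /aT ai; have := asE _ i; rewrite combB sa subrr =>
    /(_ erefl).
  by rewrite ai /s iS subr0 => /eqP; rewrite oner_eq0.
by rewrite inE => /eqP.
Qed.

(** * Circuits with two coefficients of each sign, and their centers *)

Definition pospart c : I -> R := fun i => if 0 < c i then c i else 0.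
Definition opp c : I -> R := fun i => - c i.
Definition posset c := [set i | 0 < c i].

(* The zero function is also a circuit. *)
Definition circuit c := comb c = 0 /\
  forall d, (forall i, c i = 0 -> d i = 0) -> comb d = 0 ->
    exists s, forall i, d i = s * c i.

Definition bad_circuit c := [/\ circuit c,
  exists i j, [/\ i != j, 0 < c i & 0 < c j] &
  exists i j, [/\ i != j, c i < 0 & c j < 0]].

Definition centered c k := bad_circuit c /\ comb (pospart c) = u k.

Lemma pospart_ge0 c i : 0 <= pospart c i.
Proof. by rewrite /pospart; case: ifP => // /ltW. Qed.

Lemma pospart_pos c i : 0 < c i -> pospart c i = c i.
Proof. by rewrite /pospart => ->. Qed.

Lemma pospart_supp c : supported (pospart c) (posset c).
Proof. by move=> i; rewrite inE /pospart => /negPf ->. Qed.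

Lemma posset_opp c i : (i \in posset (opp c)) = (c i < 0).
Proof. by rewrite inE oppr_gt0. Qed.

Lemma pospart_opp c i : pospart c i - pospart (opp c) i = c i.
Proof.
rewrite /pospart /opp oppr_gt0; case: (ltrgtP (c i) 0) => [_|_|->];
  rewrite ?subr0 //.
by rewrite sub0r opprK.
Qed.

Lemma comb_pospart_opp c :
  comb c = 0 -> comb (pospart (opp c)) = comb (pospart c).
Proof.
by move=> c0; apply/esym/eqP; rewrite -subr_eq0 -combB (eq_comb (pospart_opp c))
  c0.
Qed.

Lemma circuit_scale c s : s != 0 -> circuit c -> circuit (fun i => s * c i).
Proof.
move=> s0 [c0 cd]; split; first by rewrite combZ c0 scaler0.
move=> d dc d0; have [|t dt] := cd d _ d0.
  by move=> i ci; apply: dc; rewrite ci mulr0.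
by exists (t / s) => i; rewrite dt mulrA divfK.
Qed.

Lemma bad_scale c s : 0 < s -> bad_circuit c -> bad_circuit (fun i => s * c i).
Proof.
move=> s0 [cc [i [j [ij ci cj]]] [i' [j' [ij' ci' cj']]]]; split.
- by apply: circuit_scale => //; rewrite gt_eqF.
- by exists i, j; rewrite !pmulr_rgt0.
- by exists i', j'; rewrite !pmulr_rlt0.
Qed.

Lemma bad_opp c : bad_circuit c -> bad_circuit (opp c).
Proof.
move=> [cc [i [j [ij ci cj]]] [i' [j' [ij' ci' cj']]]]; split.
- have -> : opp c = (fun i => -1 * c i) by apply/funext => k; rewrite mulN1r.
  by apply: circuit_scale => //; rewrite oppr_eq0 oner_eq0.
- by exists i', j'; rewrite /opp !oppr_gt0.
- by exists i, j; rewrite /opp !oppr_lt0.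
Qed.

Lemma centered_opp c k : centered c k -> centered (opp c) k.
Proof.
move=> [bc ck]; split; first exact: bad_opp.
by have [[c0 _] _ _] := bc; rewrite comb_pospart_opp.
Qed.

Lemma unit_neq0 i : u i != 0.
Proof.
by apply/eqP => ui; have := fs_unit fsP i; rewrite ui dot0r => /esym/eqP;
  rewrite oner_eq0.
Qed.

Lemma circuit_pos c d b : circuit c -> c b < 0 -> supported d (posset c) ->
  comb d = 0 -> forall i, d i = 0.
Proof.
move=> [_ cd] cb dc d0.
have [|s ds] := cd d _ d0.
  by move=> i ci; apply: dc; rewrite inE ci ltxx.
have : d b == 0 by rewrite dc // inE -leNgt ltW.
rewrite ds mulf_eq0 (lt_eqF cb) orbF => /eqP s0 i; by rewrite ds s0 mul0r.
Qed.

(** Let w be the common value of the two sides and u_k a normal occurring in its expansion at a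
    maximizer. By [facial_comb], u_k is in both positive hulls; the difference of the two expansions
    is a multiple of c, so u_k is a positive multiple of w. *)
Lemma bad_center c : bad_circuit c ->
  exists k s, 0 < s /\ centered (fun i => s * c i) k.
Proof.
move=> bc; have [cc [a [_ [_ ca _]]] [b [_ [_ cb _]]]] := bc.
have [c0 cd] := cc; pose w := comb (pospart c).
have w0 : w != 0.
  apply/eqP => /(circuit_pos cc cb (@pospart_supp c))/(_ a).
  by rewrite pospart_pos // => /eqP; rewrite gt_eqF.
have [x Px [l [l0 lS wl]]] := max_in_pos w.
have [k lk] : exists k, l k != 0.
  apply: contrapT => /forallNP l_eq0; move: w0;
    rewrite wl /comb big1 ?eqxx // => i _.
  by have /negP := l_eq0 i; rewrite negbK => /eqP ->; rewrite scale0r.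
have fS : facial [set i | dot (u i) x == h i].
  by exists x => // i; rewrite inE => /eqP.
have [al [al0 alS kal]] := facial_comb (@pospart_ge0 c) (@pospart_supp c)
  l0 lS fS wl lk.
have [be [be0 beS kbe]] : in_pos (posset (opp c)) (u k).
  apply: (facial_comb (@pospart_ge0 _) (@pospart_supp _) l0 lS fS _ lk).
  by rewrite comb_pospart_opp.
have [||s alE] := cd (fun i => al i - be i).
- move=> i ci; rewrite alS ?beS ?subr0 //; last by rewrite inE ci ltxx.
  by rewrite posset_opp ci ltxx.
- by rewrite combB -kal -kbe subrr.
have alE' i : al i = s * pospart c i.
  rewrite /pospart; case: ifP => [ci|/negbT]; last first.
    by move=> ci; rewrite mulr0 alS // inE.
  by rewrite -alE beS ?subr0 // posset_opp -leNgt ltW.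
have kE : u k = s *: w by rewrite kal (eq_comb alE') combZ.
have s0 : 0 < s.
  rewrite lt_def; apply/andP; split.
    by apply: contraTneq (unit_neq0 k) => s0; rewrite kE s0 scale0r eqxx.
  by have := al0 a; rewrite alE' pospart_pos // pmulr_lge0.
exists k, s; split=> //; split; first exact: bad_scale.
rewrite kE -combZ; apply: eq_comb => i; rewrite /pospart pmulr_rgt0 //.
by case: ifP; rewrite ?mulr0.
Qed.

Definition minimal_at c k :=
  forall m, in_pos (posset c) (u m) -> m \in posset c \/ m = k.

Definition cone_normals c := [set i | `[< in_pos (posset c) (u i) >]].

Lemma cone_normalsP c i :
  reflect (in_pos (posset c) (u i)) (i \in cone_normals c).
Proof. by rewrite inE; exact: asboolP. Qed.

Lemma in_pos1 A i : i \in A -> in_pos A (u i).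
Proof.
move=> iA; exists (indic i); split; [by move=> j; exact: ler0n| |].
  by move=> j jA; rewrite /indic; case: eqP => // ji; rewrite ji iA in jA.
by rewrite comb_indic.
Qed.

(* u_m takes the place of u_a in A = posset c, where a minimizes c a / al a   *)
(* and u_m = comb al is the expansion of u_m on A.                            *)
Lemma circuit_replace c k m : centered c k -> in_pos (posset c) (u m) ->
    m \notin posset c -> m <> k ->
  exists2 c', bad_circuit c' & posset (opp c') = posset (opp c) /\
    cone_normals c' \proper cone_normals c.
Proof.
move=> [bc ck] [al [al0 alA mal]] mA mk.
have [cc [a1 [a2 [a12 ca1 ca2]]] [b1 [b2 [b12 cb1 cb2]]]] := bc.
have [c0 cd] := cc.
have alm : al m = 0 by exact: alA.
have Aal i : al i != 0 -> 0 < c i.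
  by move=> ai; apply: contraNT ai => ci; rewrite alA // inE.
have cm : c m = 0.
  apply/eqP; rewrite eq_le; apply/andP; split; rewrite leNgt.
    by apply: contra mA; rewrite inE.
  apply/negP => cm.
  have [||s sE] := cd (fun i => al i - indic m i).
  - move=> i ci; rewrite alA ?inE ?ci ?ltxx // /indic; case: eqP => [im|];
      last by rewrite subrr.
    by move: cm; rewrite -im ci ltxx.
  - by rewrite combB comb_indic mal subrr.
  have bm b : c b < 0 -> s * c b = - (b == m)%:R.
    by move=> cb; rewrite -sE alA ?sub0r // inE -leNgt ltW.
  have [b bm' cb] : exists2 b, b != m & c b < 0.
    have [b1m|] := eqVneq b1 m; last by exists b1.
    by exists b2 => //; rewrite -b1m eq_sym.
  have := bm b cb; rewrite (negPf bm') oppr0 => /eqP;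
    rewrite mulf_eq0 (lt_eqF cb) orbF.
  move=> /eqP s0; have := bm m cm; rewrite s0 mul0r eqxx => /eqP.
  by rewrite eq_sym oppr_eq0 oner_eq0.
have [i0 ali0] : exists i0, 0 < al i0.
  apply: contrapT => /forallNP alle; move: (unit_neq0 m).
  rewrite mal /comb big1 ?eqxx // => i _; have /negP := alle i;
    rewrite -leNgt => ai.
  have -> : al i = 0 by apply/eqP; rewrite eq_le ai al0.
  by rewrite scale0r.
have [a ala aP] : exists2 a, 0 < al a & forall i, 0 < al i ->
  c a / al a <= c i / al i.
  by case: (Order.TotalTheory.arg_minP (fun i => c i / al i) (P := fun i =>
    0 < al i) ali0) => a; exists a.
set th := c a / al a in aP.
have ca : 0 < c a by rewrite Aal // gt_eqF.
have th0 : 0 < th by rewrite divr_gt0.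
have thle i : th * al i <= c i \/ c i <= 0 /\ al i = 0.
  have := al0 i; rewrite le_eqVlt => /orP[/eqP/esym ai|ai]; last first.
    by left; rewrite -ler_pdivlMr ?aP.
  by rewrite ai mulr0; have [ci|ci] := leP 0 (c i); [left|right; split=> //;
    exact: ltW].
(* Add th times the dependency u_m - comb al = 0: th is the largest factor that keeps the
   coefficients on A nonnegative, and the one at a vanishes. *)
pose c' i := c i - th * al i + th * indic m i.
have c'a : c' a = 0.
  have am : a != m by apply: contraTneq ala => ->; rewrite alm ltxx.
  by rewrite /c' /indic (negPf am) mulr0 addr0 /th divfK ?subrr // gt_eqF.
have c'm : c' m = th by rewrite /c' cm alm indic_id mulr0 subr0 add0r mulr1.
have c'N i : i != m -> c' i = c i - th * al i.
  by move=> im; rewrite /c' indic_neq // mulr0 addr0.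
have comb_lift d : comb (fun i => d i + (d m * al i - d m * indic m i))
  = comb d.
  by rewrite combD (combB (fun i => d m * al i))
    !combZ comb_indic -mal subrr addr0.
have cc' : circuit c'.
  split.
    rewrite (combD (fun i => c i - th * al i) (fun i => th * indic m i)).
    by rewrite (combB c (fun i => th * al i)) !combZ c0 comb_indic -mal sub0r
      addNr.
  move=> d dc' d0.
  have [||s sE] := cd (fun i => d i + (d m * al i - d m * indic m i)).
  - move=> i ci; have ai : al i = 0 by apply: alA; rewrite inE ci ltxx.
    have [->|im] := eqVneq i m; first by rewrite alm indic_id; ring.
    rewrite dc' ?ai ?indic_neq //; first by ring.
    by rewrite c'N // ci ai mulr0 subr0.
  - by rewrite comb_lift.
  have dm : d m = s * th.
    have := sE a; rewrite dc' // add0r.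
    have am : a != m by apply: contraTneq ala => ->; rewrite alm ltxx.
    rewrite indic_neq // mulr0 subr0 /th => dE;
      rewrite mulrA -dE mulfK // gt_eqF //.
  exists s => i; have [->|im] := eqVneq i m; first by rewrite c'm.
  have := sE i; rewrite c'N // dm indic_neq // => dE.
  by rewrite mulrBr -dE; ring.
have c'neg i : (c' i < 0) = (c i < 0).
  have [->|im] := eqVneq i m; first by rewrite c'm cm ltxx ltNge ltW.
  rewrite c'N //; have [H|[H ->]] := thle i; last by rewrite mulr0 subr0.
  by rewrite subr_lt0 ltNge H ltNge (le_trans _ H) // mulr_ge0 // ltW.
have A'A i : 0 < c' i -> i != m -> 0 < c i.
  move=> c'i im; rewrite c'N // subr_gt0 in c'i.
  by apply: le_lt_trans c'i; rewrite mulr_ge0 // ltW.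
exists c'.
  split=> //; last by exists b1, b2; rewrite !c'neg.
  (* If m were the only positive index, u_k would be a multiple of u_m, forcing k = m. *)
  have [i [ci im]] : exists i, 0 < c' i /\ i != m.
    apply: contrapT => /forallNP noi.
    have : comb (pospart c) = th *: u m.
      rewrite mal -combZ; apply: eq_comb => i; rewrite /pospart.
      have [->|im] := eqVneq i m; first by rewrite cm ltxx alm mulr0.
      case: ifP => [ci|/negbT ci]; last by rewrite alA ?mulr0 // inE.
      have [H|[H ->]] := thle i; last by move: ci; rewrite ltNge H.
      have := noi i; rewrite im c'N // subr_gt0 => /not_andP[/negP|//].
      by rewrite -leNgt => H'; apply/eqP; rewrite eq_le H H'.
    rewrite ck => uk; have : k \in [set m].
      apply: (facial_in_pos (facial1 m)); exists (fun i => th * indic m i);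
        split.
      - by move=> i; rewrite mulr_ge0 ?indic_ge0 // ltW.
      - by move=> i; rewrite inE => im; rewrite indic_neq ?mulr0.
      - by rewrite combZ comb_indic.
    by rewrite inE => /eqP km; apply: mk.
  by exists i, m; rewrite im ci c'm.
split; first by apply/setP => i; rewrite !posset_opp c'neg.
have liftP be : (forall i, 0 <= be i) -> supported be (posset c') ->
    (forall i, 0 <= be i + (be m * al i - be m * indic m i)) /\
    supported (fun i => be i + (be m * al i - be m * indic m i)) (posset c).
  move=> be0 beA; split=> i.
    have [->|im] := eqVneq i m; first by rewrite alm indic_id; move: (be0 m);
      lra.
    by rewrite indic_neq // mulr0 subr0 addr_ge0 // mulr_ge0.
  move=> iA; rewrite (alA _ iA); have [->|im] := eqVneq i m.
    by rewrite indic_id; ring.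
  rewrite indic_neq // beA; first by ring.
  by rewrite inE; apply: contra iA => /A'A/(_ im); rewrite inE.
apply/properP; split.
  apply/fintype.subsetP => i /cone_normalsP[be [be0 beA iE]].
  apply/cone_normalsP.
  have [be0' beA'] := liftP be be0 beA.
  exists (fun i => be i + (be m * al i - be m * indic m i)).
  by split=> //; rewrite comb_lift.
exists a; first by apply/cone_normalsP/in_pos1; rewrite inE.
(* u_a has left the hull: otherwise substituting comb al for u_m and using the independence of A
   would make u_m a multiple of u_a. *)
apply/negP => /cone_normalsP[be [be0 beA aE]].
have [be0' beA'] := liftP be be0 beA.
have beE : forall i, indic a i - (be i + (be m * al i - be m * indic m i)) = 0.
  apply: (circuit_pos cc cb1) => [i iA|]; last
    by rewrite combB comb_lift comb_indic aE subrr.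
  rewrite beA' // subr0 /indic; case: eqP => // ia; by rewrite ia inE ca in iA.
have am : a != m by apply: contraTneq ala => ->; rewrite alm ltxx.
have bem : be m != 0.
  apply/eqP => bem; have := beE a; rewrite bem !mul0r subrr addr0 indic_id beA.
    by move/eqP; rewrite subr0 oner_eq0.
  by rewrite inE c'a ltxx.
have ali i : i != a -> al i = 0.
  move=> ia; have [->//|im] := eqVneq i m.
  have := beE i; rewrite !indic_neq // mulr0 subr0 sub0r => /eqP.
  rewrite oppr_eq0 paddr_eq0 ?mulr_ge0 // => /andP[_].
  by rewrite mulf_eq0 (negPf bem) => /eqP.
have : m \in [set a].
  apply: (facial_in_pos (facial1 a)); exists al; split=> // i.
  by rewrite inE; exact: ali.
by rewrite inE eq_sym (negPf am).
Qed.

(** Induction on the number of normals in the two positive hulls: [circuit_replace], applied to c or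
    to its opposite, shrinks one hull and keeps the other. The center is recomputed after each
    replacement. *)
Lemma minimal_center c : bad_circuit c -> exists c' k,
  [/\ centered c' k, minimal_at c' k & minimal_at (opp c') k].
Proof.
have [N] := ubnP (#|cone_normals c| + #|cone_normals (opp c)|)%N.
elim: N c => // N IHN c leN bc.
have [k [s [s0 ck]]] := bad_center bc; set c1 := (fun i => s * c i) in ck.
have posE : posset c1 = posset c by apply/setP => i; rewrite !inE pmulr_rgt0.
have negE : posset (opp c1) = posset (opp c).
  by apply/setP => i; rewrite !posset_opp pmulr_rlt0.
have coneE d d' : posset d = posset d' -> cone_normals d = cone_normals d'.
  by rewrite /cone_normals => ->.
have {}leN : (#|cone_normals c1| + #|cone_normals (opp c1)| < N.+1)%N.
  by rewrite (coneE _ _ posE) (coneE _ _ negE).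
have min_or d : centered d k -> minimal_at d k \/ exists2 d', bad_circuit d' &
    posset (opp d') = posset (opp d) /\ cone_normals d' \proper cone_normals d.
  move=> dk; have [|/existsNP[m /not_implyP[mA /not_orP[mN mk]]]]
    := pselect (minimal_at d k).
    by left.
  by right; apply: circuit_replace dk mA _ mk; apply/negP.
have [m1|[c' bc' [negE' /proper_card lt']]] := min_or _ ck; last first.
  apply: (IHN c') => //; rewrite (coneE _ _ negE').
  by rewrite -ltnS; apply: leq_trans leN; rewrite ltnS ltn_add2r.
have [m2|[c' bc' [negE' /proper_card lt']]] := min_or _ (centered_opp ck);
  last first.
  apply: (IHN c') => //; rewrite (coneE (opp c') c1); last first.
    by rewrite negE'; congr posset; apply/funext => i; rewrite /opp opprK.
  by rewrite -ltnS; apply: leq_trans leN; rewrite ltnS addnC ltn_add2l.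
by exists c1, k.
Qed.

(** * Faces around a minimal center, and the grid of points *)

Lemma centered_notin c k D : centered c k -> indep (posset c :|: D) ->
  k \notin posset c :|: D.
Proof.
move=> [[_ [i [j [ij ci cj]]] _] ck] ind; apply/negP => kAD.
have E : forall i, pospart c i - indic k i = 0.
  apply: ind => [l lAD|]; last by rewrite combB ck comb_indic subrr.
  rewrite pospart_supp ?indic_neq ?subrr //; last first.
    by apply: contra lAD => lA; rewrite inE lA.
  by apply: contraNneq lAD => ->.
have kE l : 0 < c l -> l = k.
  move=> cl; apply: contraTeq cl => lk; have := E l.
  rewrite indic_neq // subr0 /pospart; case: ifP => // cl cl0.
  by rewrite cl0 ltxx in cl.
by move: ij; rewrite (kE i) // (kE j) // eqxx.
Qed.

(* If the positive hull of k, D and A \ a contained a further u_m, adding a   *)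
(* multiple of u_k = sum_A c_i u_i to its expansion would turn a positive     *)
(* combination of k and D into one of m and A \ b for some b; by facial_comb  *)
(* u_k would be in the positive hull of the latter, which is impossible.      *)
Lemma link_facial c k D a : centered c k -> minimal_at c k ->
    facial (k |: D) -> indep (posset c :|: D) -> [disjoint posset c & D] ->
    a \in posset c ->
  facial (k |: D :|: (posset c :\ a)).
Proof.
move=> ck minc fkD ind dis aA; set A := posset c in ind dis aA *.
have kAD : k \notin A :|: D by exact: centered_notin.
have [kA kD] : k \notin A /\ k \notin D.
  by apply/andP; rewrite -negb_or -finset.in_setU.
have AD i : i \in A -> i \notin D by move=> iA; rewrite (disjointFr dis).
have ca : 0 < c a by move: aA; rewrite inE.
have ak : a != k by apply: contraNneq kA => <-.
have [[_ [a1 [a2 [a12 ca1 ca2]]] _] ckE] := ck.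
have [a' a'a ca'] : exists2 a', a' != a & 0 < c a'.
  have [a1a|] := eqVneq a1 a; last by exists a1.
  by exists a2 => //; rewrite -a1a eq_sym.
have aS : a \notin k |: D :|: (A :\ a).
  by rewrite !inE (negPf ak) eqxx /= orbF; exact: AD.
(* Replaces u_k by its expansion on A, which moves a combination into the independent set A, D. *)
pose lift (x : I -> R) i := x i + (x k * pospart c i - x k * indic k i).
have comb_lift (x : I -> R) : comb (lift x) = comb x.
  rewrite combD (combB (fun i => x k * pospart c i)) !combZ comb_indic ckE.
  by rewrite subrr addr0.
have liftN (x : I -> R) i : i != k -> lift x i = x i + x k * pospart c i.
  by move=> ik; rewrite /lift indic_neq // mulr0 subr0.
have liftS (x : I -> R) : supported x (k |: D :|: (A :\ a)) ->
  supported (lift x) (A :|: D).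
  move=> xS i iAD; have [->|ik] := eqVneq i k.
    by rewrite /lift indic_id pospart_supp //; ring.
  move: (iAD); rewrite inE => /norP[iA iD].
  rewrite liftN // pospart_supp // mulr0 addr0 xS // !inE (negPf ik) (negPf iD)
    /=.
  by move: iA; rewrite inE => /negPf ->; rewrite andbF.
apply: primitive_facial => [d dS d0|m [x [x0 xS mx]]].
  have dl : forall i, lift d i = 0 by apply: ind; rewrite ?comb_lift //;
    exact: liftS.
  have dk : d k = 0.
    have := dl a; rewrite liftN // dS // add0r pospart_pos // => /eqP.
    by rewrite mulf_eq0 (gt_eqF ca) orbF => /eqP.
  by move=> i; have := dl i; rewrite /lift dk !mul0r subrr addr0.
apply: contraT => mS.
have mk : m != k by apply: contraNneq mS => ->; rewrite !inE eqxx.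
pose y := lift x; have yS : supported y (A :|: D) by exact: liftS.
have my : u m = comb y by rewrite comb_lift.
have yk : y k = 0 by rewrite /y /lift indic_id pospart_supp //; ring.
have y0 i : 0 <= y i.
  have [->|ik] := eqVneq i k; first by rewrite yk.
  by rewrite /y liftN // addr_ge0 // mulr_ge0 // pospart_ge0.
have mD : m \notin D by apply: contra mS => mD; rewrite !inE mD orbT.
have mA : m \notin A.
  apply/negP => mA; have ma : m = a.
    by apply/eqP; apply: contraNT mS => ma; rewrite finset.in_setU
      finset.in_setD1 ma mA orbT.
  have yE : forall i, indic m i - y i = 0.
    apply: ind => [i iAD|]; last by rewrite combB comb_indic my subrr.
    rewrite yS // subr0 indic_neq //; apply: contraNneq iAD => ->.
    by rewrite inE mA.
  have xk : x k != 0.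
    apply/eqP => xk; have := yE m; rewrite indic_id /y liftN // xk mul0r addr0
      xS //.
    by move/eqP; rewrite subr0 oner_eq0.
  have a'k : a' != k by apply: contraNneq kA => <-; rewrite inE.
  have := yE a'; rewrite ma indic_neq // sub0r /y liftN // pospart_pos // =>
    /eqP.
  rewrite oppr_eq0 paddr_eq0 ?mulr_ge0 ?(ltW ca') // => /andP[_].
  by rewrite mulf_eq0 (negPf xk) (gt_eqF ca').
have mAD : m \notin A :|: D by rewrite inE negb_or mA.
have fD : facial D by apply: facialS fkD; exact: finset.subsetUr.
have [yD|] := pselect (forall i, i \in D -> y i = 0).
  have [|mA'|mk'] := minc m.
  - exists y; split=> // i iA; have [/yD //|iD] := boolP (i \in D).
    by apply: yS; rewrite inE negb_or iA.
  - by rewrite mA' in mA.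
  - by rewrite mk' eqxx in mk.
move=> /existsNP[j /not_implyP[jD /eqP yj]].
have [yA|] := pselect (forall i, i \in A -> y i = 0).
  move: mD; rewrite (facial_in_pos fD) //; exists y; split=> // i iD.
  have [/yA //|iA] := boolP (i \in A).
  by apply: yS; rewrite inE negb_or iA.
move=> /existsNP[i0 /not_implyP[i0A /eqP yi0]].
have [b bA bP] : exists2 b, b \in A & forall i, i \in A ->
  y i / c i <= y b / c b.
  by case: (Order.TotalTheory.arg_maxP (fun i => y i / c i) i0A) => b; exists b.
have cA i : i \in A -> 0 < c i by rewrite inE.
set t := y b / c b in bP.
have t0 : 0 < t.
  by apply: lt_le_trans (bP _ i0A); rewrite divr_gt0 ?cA // lt_def yi0 y0.
pose yD i := if i \in D then y i else 0.
have ADE i : y i = (if i \in A then y i else 0) + yD i.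
  rewrite /yD; case: ifP => [/AD/negPf ->|iA]; first by rewrite addr0.
  case: ifP => [|iD]; first by rewrite add0r.
  by rewrite addr0 yS // inE iA iD.
(* Both sides of u_m + (t u_k - y_A) = y_D + t u_k, with u_k expanded on the left. The choice of t
   makes the left coefficients nonnegative and the one at b zero. *)
pose nu i := indic m i + (t * pospart c i - (if i \in A then y i else 0)).
pose mu i := yD i + t * indic k i.
have cmb : comb nu = comb mu.
  rewrite (combD (indic m)) (combB (fun i => t * pospart c i)) (combD yD)
    !combZ.
  rewrite !comb_indic ckE my (eq_comb ADE) combD.
  by rewrite [_ + comb yD]addrC addrACA subrr addr0.
have [be [be0 beS kbe]] : in_pos (m |: (A :\ b)) (u k).
  apply: (facial_comb _ _ _ _ fkD cmb).
  - move=> i; rewrite addr_ge0 ?indic_ge0 // subr_ge0; case: ifP => [iA|_].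
      by rewrite pospart_pos ?cA // -ler_pdivrMr ?cA // bP.
    by rewrite mulr_ge0 ?pospart_ge0 // ltW.
  - move=> i; rewrite !inE negb_or negb_and negbK => /andP[im].
    rewrite /nu indic_neq // add0r => /orP[/eqP ->|iA].
      by rewrite bA pospart_pos ?cA // /t divfK ?subrr // gt_eqF ?cA.
    have iA' : i \notin A by rewrite inE.
    by rewrite pospart_supp // mulr0 ifN // subrr.
  - move=> i; rewrite /mu /yD addr_ge0 //; first by case: ifP.
    by apply: mulr_ge0; [exact: ltW|exact: indic_ge0].
  - move=> i; rewrite !inE negb_or => /andP[ik iD].
    by rewrite /mu /yD (negPf iD) indic_neq // mulr0 addr0.
  - by rewrite /mu /yD (negPf kD) add0r indic_id mulr1 gt_eqF.
(* Substitute y for u_m in the expansion of u_k and compare coefficients: at j in D this gives be m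
   = 0, and then at b it gives c b = 0. *)
have beE : forall i, be i + (be m * y i - be m * indic m i) - pospart c i = 0.
  apply: ind => [i iAD|]; last first.
    rewrite (combB (fun i => be i + (be m * y i - be m * indic m i))) combD.
    by rewrite (combB (fun i => be m * y i)) !combZ comb_indic -my ckE -kbe
      subrr addr0 subrr.
  rewrite yS // pospart_supp; last by apply: contra iAD => iA; rewrite inE iA.
  have [->|im] := eqVneq i m; first by rewrite indic_id; ring.
  rewrite indic_neq // beS; first by ring.
  rewrite !inE (negPf im) /= negb_and; apply/orP; right.
  by apply: contra iAD => iA; rewrite !inE iA.
have bem : be m = 0.
  have jA : j \notin A by apply/negP => /AD; rewrite jD.
  have jm : j != m by apply: contraNneq mD => <-.
  have := beE j; rewrite indic_neq // pospart_supp // beS; last first.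
    by rewrite finset.in_setU1 finset.in_setD1 negb_or jm negb_and jA orbT.
  rewrite add0r mulr0 !subr0 => /eqP.
  by rewrite mulf_eq0 (negPf yj) orbF => /eqP.
have := beE b; rewrite bem !mul0r subrr addr0 pospart_pos ?cA // beS.
  by move/eqP; rewrite sub0r oppr_eq0 gt_eqF // cA.
by rewrite finset.in_setU1 finset.in_setD1 eqxx orbF;
  apply: contraNneq mA => <-.
Qed.

Lemma exists_dot_gt0 x : x != 0 -> exists i, 0 < dot (u i) x.
Proof.
move=> x0; apply: contrapT => /forallNP xle.
have [p Pp pmax] := fs_max fsP x.
have := pmax (x + p); rewrite dotDr gerDr leNgt dot_gt0 // => H.
suff Pxp : P (x + p) by have := H Pxp.
apply/(fs_mem fsP) => i; rewrite dotDr -[h i]add0r lerD ?P_le //.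
by rewrite leNgt; apply/negP.
Qed.

(** Take C maximal. If some x != 0 is orthogonal to all normals of S and C, walk along x from a
    common point until a first new facet i is hit. Since u_i x > 0 while E and C vanish on x, i
    could be added to C. *)
Lemma extend_spanning S E : facial S ->
    (forall x, (forall i, i \in S -> dot (u i) x = 0) ->
       forall i, i \in E -> dot (u i) x = 0) ->
  exists C, [/\ facial (S :|: C), [disjoint E & C],
    forall x, (forall i, i \in S :|: C -> dot (u i) x = 0) -> x = 0 &
    forall d, supported d (E :|: C) -> comb d = 0 -> forall i, i \in C ->
      d i = 0].
Proof.
move=> fS SE.
pose good C := [/\ facial (S :|: C), [disjoint E & C] &
  forall d, supported d (E :|: C) -> comb d = 0 -> forall i, i \in C ->
    d i = 0].
have good0 : `[< good finset.set0 >].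
  apply/asboolP; split=> [||d _ _ i]; last by rewrite inE.
    by rewrite finset.setU0.
  by rewrite -finset.setI_eq0 finset.setI0.
have [C /maxsetP[/asboolP[fC dC depC] maxC] _] :=
  maxset_exists (P := fun C => `[< good C >]) good0.
exists C; split=> // x xSC; apply/eqP; apply: contraT => x0.
have [i0 i0x] := exists_dot_gt0 x0.
have [p Pp pSC] := fC.
pose gap i := (h i - dot (u i) p) / dot (u i) x.
have [i ix imin] : exists2 i, 0 < dot (u i) x &
    forall j, 0 < dot (u j) x -> gap i <= gap j.
  by case: (Order.TotalTheory.arg_minP gap (P := fun i => 0 < dot (u i) x) i0x)
    => i; exists i.
have gap0 : 0 <= gap i by rewrite divr_ge0 ?(ltW ix) // subr_ge0 P_le.
have iE : i \notin E.
  by apply: contraTN ix => /SE -> //; rewrite ?ltxx // => j jS; apply: xSC;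
    rewrite inE jS.
have iC : i \notin C.
  by apply: contraTN ix => iC; rewrite xSC ?ltxx // inE iC orbT.
have /maxC : `[< good (i |: C) >].
  apply/asboolP; split.
  - exists (p + gap i *: x).
      apply/(fs_mem fsP) => j; rewrite dotDr dotZr -lerBrDl.
      have [jx|jx] := ltrP 0 (dot (u j) x); first
        by rewrite -ler_pdivlMr // imin.
      by rewrite (le_trans (y := 0)) ?subr_ge0 ?P_le // mulr_ge0_le0.
    move=> j; rewrite finset.setUCA finset.in_setU1 => /orP[/eqP ->|jSC].
      by rewrite dotDr dotZr /gap divfK ?gt_eqF // addrC subrK.
    by rewrite dotDr dotZr xSC // mulr0 addr0 pSC.
  - rewrite disjoint_subset; apply/fintype.subsetP => j jE.
    rewrite !inE negb_or (disjointFr dC) // andbT.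
    by apply: contraNneq iE => <-.
  - move=> d dS d0.
    have di : d i = 0.
      have : dot (comb d) x = d i * dot (u i) x.
        rewrite dot_comb (bigD1 i) //= big1 ?addr0 // => j ji.
        have [jE|jE] := boolP (j \in E :|: C); last first.
          by rewrite dS ?mul0r // finset.setUCA finset.in_setU1 negb_or ji.
        suff -> : dot (u j) x = 0 by rewrite mulr0.
        move: jE; rewrite finset.in_setU => /orP[jE|jC].
          by apply: SE jE => l lS; apply: xSC; rewrite inE lS.
        by apply: xSC; rewrite inE jC orbT.
      by rewrite d0 dot0l => /esym/eqP; rewrite mulf_eq0 (gt_eqF ix) orbF =>
        /eqP.
    move=> j; rewrite finset.in_setU1 => /orP[/eqP -> //|jC].
    apply: depC jC => // l lEC; have [-> //|li] := eqVneq l i.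
    by apply: dS; rewrite finset.setUCA finset.in_setU1 negb_or li.
move=> /(_ (finset.subsetUr _ _)) CE.
by move: iC; rewrite -CE setU11.
Qed.

(** Farkas' lemma with both signs of each u_i; the boolean is the sign. *)
Lemma off_span S w : (forall d, supported d S -> comb d <> w) ->
  exists2 x, (forall i, i \in S -> dot (u i) x = 0) & dot w x < 0.
Proof.
move=> wS; apply: contrapT => /forall2NP nox.
have noneg x : (forall i, i \in S -> dot (u i) x = 0) -> 0 <= dot w x.
  by move=> xS; have [/(_ xS)//|/negP] := nox x; rewrite -leNgt.
pose T := [set p : I * bool | p.1 \in S].
have [||x xT|l [l0 lT lE]] := @farkas_set R V (I * bool)%type T
   (fun p => dot ((-1) ^+ p.2 *: u p.1)) (dot w).
- by move=> i; exact: dot_functional.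
- exact: dot_functional.
- rewrite -oppr_ge0 -dotNr; apply: noneg => i iS; rewrite dotNr.
  have := xT (i, true); have := xT (i, false); rewrite !inE /= => /(_ iS)
    H1 /(_ iS).
  move: H1; rewrite expr0 scale1r expr1 scaleN1r dotNl => H1 H2.
  by apply/eqP; rewrite oppr_eq0 eq_le H1 /= -oppr_le0.
- apply: (wS (fun i => l (i, false) - l (i, true))).
    by move=> i iS; rewrite !lT ?subrr // inE.
  apply: eq_dot => z; rewrite lE dot_comb.
  rewrite [RHS](eq_bigr (fun p => l (p.1, p.2) * dot ((-1) ^+ p.2 *: u p.1) z));
    last by case.
  rewrite -(pair_bigA _ (fun i b => l (i, b) * dot ((-1) ^+ b *: u i) z)) /=.
  apply: eq_bigr => i _; rewrite (bigD1 true) //= (bigD1 false) //= big_pred0;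
    last by case.
  rewrite expr0 expr1 scale1r scaleN1r dotNl; ring.
Qed.

Lemma dot_center c k x : comb (pospart c) = u k ->
  dot (u k) x = \sum_(i in posset c) c i * dot (u i) x.
Proof.
move=> <-; rewrite dot_comb [RHS]big_mkcond; apply: eq_bigr => i _.
by rewrite inE /pospart; case: ifP; rewrite ?mul0r.
Qed.

Lemma center_perp c k a x : comb (pospart c) = u k -> a \in posset c ->
    dot (u k) x = 0 -> (forall i, i \in posset c :\ a -> dot (u i) x = 0) ->
  forall i, i \in posset c -> dot (u i) x = 0.
Proof.
move=> ck aA kx Ax i iA; have [->|ia] := eqVneq i a; last first.
  by apply: Ax; rewrite finset.in_setD1 ia.
have := dot_center x ck; rewrite kx (bigD1 a) //= big1 => [|j /andP[jA ja]].
  rewrite addr0 => /esym/eqP; rewrite mulf_eq0 => /orP[|/eqP //].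
  by move: aA; rewrite inE => /gt_eqF ->.
by rewrite Ax ?mulr0 // finset.in_setD1 ja.
Qed.

Lemma circuit_indep c A D b : (forall d, supported d (A :|: D) -> comb d = 0 ->
    exists s, forall i, d i = s * c i) ->
  c b != 0 -> b \notin D -> indep ((A :\ b) :|: D).
Proof.
move=> dep cb bD d dS d0.
have [|s ds] := dep d _ d0.
  move=> i; rewrite finset.in_setU negb_or => /andP[iA iD]; apply: dS.
  by rewrite finset.in_setU negb_or iD andbT !inE negb_and iA orbT.
have : d b = 0 by apply: dS; rewrite !inE eqxx.
rewrite ds => /eqP; rewrite mulf_eq0 (negPf cb) orbF => /eqP s0 i.
by rewrite ds s0 mul0r.
Qed.

(* C turns the faces into vertices: since the equations indexed by k, A, B    *)
(* and C have full rank, the grid constructed below is an affine image of a   *)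
(* product of two finite sets.                                                *)
Lemma exists_frame c k :
    centered c k -> minimal_at c k -> minimal_at (opp c) k ->
  let A := posset c in let B := posset (opp c) in exists C,
  [/\ forall a b, a \in A -> b \in B -> facial (k |: (C :|: A :\ a) :|: B :\ b),
      [disjoint A :|: B & C],
      forall x, (forall i, i \in k |: (A :|: B :|: C) -> dot (u i) x = 0) ->
        x = 0 &
      forall d, supported d (A :|: B :|: C) -> comb d = 0 ->
        exists s, forall i, d i = s * c i].
Proof.
move=> ck minc minc' A B.
have ck' := centered_opp ck.
have [[cc [a0 [_ [_ ca0 _]]] [b0 [_ [_ cb0 _]]]] ckE] := ck.
have [c0 cd] := cc; have [_ ckE'] := ck'.
have a0A : a0 \in A by rewrite inE.
have b0B : b0 \in B by rewrite posset_opp.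
have disAB : [disjoint A & B].
  rewrite disjoint_subset; apply/fintype.subsetP => i;
    rewrite !inE oppr_gt0 => ci.
  by rewrite -leNgt ltW.
have cAB i : c i != 0 -> i \in A :|: B.
  by rewrite finset.in_setU posset_opp inE orbC neq_lt.
have dep0 d : supported d (A :|: B) -> comb d = 0 -> exists s, forall i,
  d i = s * c i.
  move=> dS d0; apply: cd => // i ci; apply: dS.
  by rewrite !inE /opp ci oppr0 ltxx.
have dep0' d : supported d (B :|: A) -> comb d = 0 -> exists s, forall i,
  d i = s * c i.
  by rewrite finset.setUC; exact: dep0.
have neq0 i : i \in A :|: B -> c i != 0.
  by rewrite finset.in_setU posset_opp inE neq_lt orbC.
have ca0' : c a0 != 0 by rewrite gt_eqF.
have cb0' : c b0 != 0 by rewrite lt_eqF.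
(* The face is built from facet k alone, first adding B without b0, then A without a0. *)
have fkB : facial (k |: finset.set0 :|: (B :\ b0)).
  apply: (@link_facial (opp c)) => //.
  - by rewrite finset.setU0; exact: facial1.
  - rewrite finset.setU0 => d dB d0.
    have [|s ds] := dep0 d _ d0.
      by move=> i; rewrite finset.in_setU negb_or => /andP[_]; exact: dB.
    have /eqP : d a0 = 0 by apply: dB; rewrite (disjointFr disAB).
    by rewrite ds mulf_eq0 (negPf ca0') orbF => /eqP s0 i; rewrite ds s0 mul0r.
  - by rewrite -finset.setI_eq0 finset.setI0.
rewrite finset.setU0 in fkB.
have fS : facial (k |: (B :\ b0) :|: (A :\ a0)).
  apply: link_facial => //; last by rewrite (disjointWr (subsetDl _ _)).
  rewrite finset.setUC; apply: (circuit_indep dep0') => //.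
  by rewrite (disjointFl disAB).
set S := k |: (B :\ b0) :|: (A :\ a0) in fS.
have kS : k \in S by rewrite !inE eqxx.
have perpS x : (forall i, i \in S -> dot (u i) x = 0) ->
    forall i, i \in A :|: B -> dot (u i) x = 0.
  move=> xS i; rewrite finset.in_setU => /orP[iA|iB].
    apply: (center_perp ckE a0A) iA; first exact: xS.
    by move=> j jA; apply: xS; rewrite finset.in_setU jA orbT.
  apply: (center_perp ckE' b0B) iB; first exact: xS.
  by move=> j jB; apply: xS; rewrite !finset.in_setU jB orbT.
have [C [fSC disC span depC]] := extend_spanning fS perpS.
have dep d : supported d (A :|: B :|: C) -> comb d = 0 ->
    exists s, forall i, d i = s * c i.
  move=> dS d0; apply: dep0 => // i iAB.
  have [iC|iC] := boolP (i \in C); first exact: (depC d).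
  by apply: dS; rewrite finset.in_setU negb_or iAB.
have disU (X Y Z : {set I}) : [disjoint X & Y] -> [disjoint X & Z] ->
  [disjoint X & Y :|: Z].
  rewrite -!finset.setI_eq0 finset.setIUr => /eqP -> /eqP ->.
  by rewrite finset.setU0.
have disAC : [disjoint A & C] by apply: disjointWl disC; exact: finset.subsetUl.
have disBC : [disjoint B & C] by apply: disjointWl disC; exact: finset.subsetUr.
have disBA : [disjoint B & A] by rewrite disjoint_sym.
(* The omitted indices are exchanged one side at a time: drop the A part and refill it without a,
   then likewise for B and b. *)
have facialA a : a \in A -> facial (k |: (C :|: B :\ b0) :|: A :\ a).
  move=> aA; apply: link_facial => //.
  - apply: facialS fSC; apply/fintype.subsetP => i; rewrite /S !finset.in_setU.
    by case/or3P => ->; rewrite ?orbT.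
  - rewrite finset.setUA finset.setUC.
    apply: (@circuit_indep c); rewrite ?finset.setUA ?(finset.setUC B) //.
    by rewrite finset.in_setU negb_or (disjointFl disAB) // (disjointFr disBC).
  - by apply: disU => //; apply: disjointWr disAB; exact: subsetDl.
exists C; split=> // [a b aA bB|x xS].
  apply: (@link_facial (opp c)) => //.
  - apply: facialS (facialA a aA); apply/fintype.subsetP => i;
      rewrite !finset.in_setU.
    by case/or3P => ->; rewrite ?orbT.
  - rewrite finset.setUA finset.setUC.
    apply: (@circuit_indep c); rewrite ?finset.setUA ?neq0 //.
      by rewrite finset.in_setU aA.
    by rewrite finset.in_setU negb_or (disjointFr disAB) // (disjointFr disAC).
  - by apply: disU => //; apply: disjointWr disBA; exact: subsetDl.
apply: span => i; rewrite /S !finset.in_setU !finset.in_setD1 => iS; apply: xS.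
rewrite !finset.in_setU; case/orP: iS => [/orP[/orP[->|/andP[_ ->]]|/andP[_
  ->]]|->];
  by rewrite ?orbT.
Qed.

(** On the face omitting a and b, join a point q on facet k to a point r off it, and take the point
    of the segment at depth e, with e below all the available depths. Changing b alone moves the
    point orthogonally to A, changing a alone orthogonally to B; hence the alternating sum is
    orthogonal to k, A, B and C, and vanishes. *)
Lemma exists_grid c k :
    centered c k -> minimal_at c k -> minimal_at (opp c) k ->
  let A := posset c in let B := posset (opp c) in
  exists (p : I -> I -> V) e, [/\ 0 < e,
    forall a b, a \in A -> b \in B -> P (p a b) /\ dot (u k) (p a b) = h k - e,
    forall a b i, a \in A -> b \in B -> i \in A :\ a :|: B :\ b ->
      dot (u i) (p a b) = h i &
    forall a b a' b', a \in A -> b \in B -> a' \in A -> b' \in B ->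
      p a b + p a' b' = p a b' + p a' b].
Proof.
move=> ck minc minc' A B.
have ck' := centered_opp ck.
have [C [fC disC span dep]] := exists_frame ck minc minc'.
have [[cc _ _] ckE] := ck; have [c0 _] := cc; have [_ ckE'] := ck'.
have disAB i : i \in A -> i \notin B by rewrite !inE oppr_gt0 -leNgt => /ltW.
pose T a b := C :|: A :\ a :|: B :\ b.
pose off (p : I * I) x := [/\ P x, forall i, i \in T p.1 p.2 -> dot (u i)
  x = h i &
  dot (u k) x < h k].
pose top (p : I * I) x := [/\ P x, forall i, i \in T p.1 p.2 -> dot (u i)
  x = h i &
  dot (u k) x = h k].
have /choice[q qP] : forall p : I * I, exists x, p.1 \in A -> p.2 \in B ->
  top p x.
  move=> [a b]; have [/andP[aA bB]|/nandP ab] := boolP ((a \in A) && (b \in B)).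
    have [x Px xE] := fC a b aA bB; exists x => _ _; split=> //.
      by move=> i iT; apply: xE; rewrite -finset.setUA finset.in_setU1 iT orbT.
    by apply: xE; rewrite !inE eqxx.
  by exists 0 => /= aA bB; move: ab; rewrite aA bB; case.
have /choice[r rP] : forall p : I * I, exists x, p.1 \in A -> p.2 \in B ->
  off p x.
  move=> [a b]; have [/andP[aA bB]|/nandP ab] := boolP ((a \in A) && (b \in B));
    last first.
    by exists 0 => /= aA bB; move: ab; rewrite aA bB; case.
  have fT : facial (T a b).
    by apply: facialS (fC a b aA bB); rewrite -finset.setUA;
      exact: finset.subsetUr.
  (* u_k is not in the span of T a b: otherwise subtracting would give a multiple s c of the circuit
     with s = 0 by its entry at b, although its entry at a is positive. *)
  have [d dT dk|x xT xk] := @off_span (T a b) (u k).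
    have nTa i : i \notin A :|: B :|: C -> i \notin T a b.
      by apply: contra; rewrite /T !finset.in_setU !finset.in_setD1 =>
        /orP[/orP[->|/andP[_ ->]]|/andP[_ ->]];
        rewrite ?orbT.
    have [||s sE] := dep (fun i => pospart c i - d i).
    - move=> i iN; rewrite dT ?nTa // subr0; apply: pospart_supp.
      by apply: contra iN => iA; rewrite !finset.in_setU iA.
    - by rewrite combB ckE dk subrr.
    have nT i : i \in A :|: B -> i \in [set a; b] -> i \notin T a b.
      move=> iAB; rewrite finset.in_set2 /T !finset.in_setU !finset.in_setD1.
      rewrite (disjointFr disC iAB) => /orP[]/eqP ->.
        by rewrite eqxx (negPf (disAB _ aA)) andbF.
      by rewrite eqxx (negPf (contraL (disAB b) bB)) andbF.
    have sb : s = 0.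
      have := sE b; rewrite dT; last first.
        apply: nT; first by rewrite finset.in_setU bB orbT.
        by rewrite finset.in_set2 eqxx orbT.
      rewrite pospart_supp ?(contraL (disAB b) bB) // subrr => /esym/eqP.
      by rewrite mulf_eq0 => /orP[/eqP //|]; rewrite lt_eqF // -posset_opp.
    have := sE a; rewrite dT; last first.
      apply: nT; first by rewrite finset.in_setU aA.
      by rewrite finset.in_set2 eqxx.
    rewrite subr0 sb mul0r pospart_pos.
      by move/eqP; rewrite gt_eqF //; move: aA; rewrite inE.
    by move: aA; rewrite inE.
  by have [y yP] := facial_off fT xT xk; exists y.
pose good (p : I * I) := (p.1 \in A) && (p.2 \in B).
pose gap p := h k - dot (u k) (r p).
have gap0 p : good p -> 0 < gap p.
  by move=> /andP[aA bB]; rewrite subr_gt0; have [] := rP p aA bB.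
have [e e0 eP] := exists_lb_gt0 gap0.
have [pt ptE] : exists pt : I -> I -> V, forall a b,
    pt a b = q (a, b) + (e / gap (a, b)) *: (r (a, b) - q (a, b)).
  by exists (fun a b => q (a, b) + (e / gap (a, b)) *: (r (a, b) - q (a, b))).
have ptT a b i : a \in A -> b \in B -> i \in T a b -> dot (u i) (pt a b) = h i.
  move=> aA bB iT; have [_ qT _] := qP (a, b) aA bB;
    have [_ rT _] := rP (a, b) aA bB.
  by rewrite ptE dotDr dotZr dotBr qT // rT // subrr mulr0 addr0.
have ptk a b : a \in A -> b \in B -> dot (u k) (pt a b) = h k - e.
  move=> aA bB; have [_ _ qk] := qP (a, b) aA bB.
  have g0 : 0 < gap (a, b) by apply: gap0; rewrite /good aA bB.
  rewrite ptE dotDr dotZr dotBr qk; have -> : dot (u k) (r (a, b))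
    = h k - gap (a, b).
    by rewrite /gap; ring.
  by field; rewrite gt_eqF.
have ptA a b b' i : a \in A -> b \in B -> b' \in B -> i \in A ->
    dot (u i) (pt a b - pt a b') = 0.
  move=> aA bB b'B; apply: (center_perp ckE aA);
    first by rewrite dotBr !ptk // subrr.
  by move=> j jA; rewrite dotBr !ptT ?subrr // /T !finset.in_setU jA orbT.
have ptB a a' b i : a \in A -> a' \in A -> b \in B -> i \in B ->
    dot (u i) (pt a b - pt a' b) = 0.
  move=> aA a'A bB; apply: (center_perp ckE' bB);
    first by rewrite dotBr !ptk // subrr.
  by move=> j jB; rewrite dotBr !ptT ?subrr // /T !finset.in_setU jB orbT.
exists pt, e; split=> // [a b aA bB|a b i aA bB iAB|a b a' b' aA bB a'A b'B].
- split; last exact: ptk.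
  have [/(fs_mem fsP) Pq _ _] := qP (a, b) aA bB.
  have [/(fs_mem fsP) Pr _ _] := rP (a, b) aA bB.
  have g0 : 0 < gap (a, b) by apply: gap0; rewrite /good aA bB.
  apply/(fs_mem fsP) => i; rewrite ptE dotDr dotZr dotBr.
  have t0 : 0 <= e / gap (a, b) by rewrite divr_ge0 // ltW.
  have t1 : e / gap (a, b) <= 1 by rewrite ler_pdivrMr // mul1r eP // /good aA
    bB.
  by move: (Pq i) (Pr i); nra.
- by apply: ptT => //; rewrite /T -finset.setUA finset.in_setU iAB orbT.
apply/eqP; rewrite -subr_eq0; apply/eqP; apply: span => i.
rewrite finset.in_setU1 !finset.in_setU => /orP[/eqP ->|/orP[/orP[iA|iB]|iC]].
- by rewrite dotBr !dotDr !ptk // subrr.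
- move: (ptA a b b' i aA bB b'B iA) (ptA a' b b' i a'A bB b'B iA).
  by rewrite !(dotBr, dotDr); lra.
- move: (ptB a a' b i aA a'A bB iB) (ptB a a' b' i aA a'A b'B iB).
  by rewrite !(dotBr, dotDr); lra.
- by rewrite dotBr !dotDr !ptT ?subrr // /T !finset.in_setU iC.
Qed.

(* On the set X of the x such that x + p a b0 is in P for all a, u_k is at    *)
(* most 0; as X contains all p a0 b - p a0 b0, u_k is at most h_k - e on any  *)
(* Y with X + Y = P.                                                          *)
Lemma no_bad_circuit c : ~ bad_circuit c.
Proof.
move=> /minimal_center[{}c [k [ck minc minc']]].
have [p [e [e0 pP pT pp]]] := exists_grid ck minc minc'.
have [_ ckE'] := centered_opp ck.
have [[_ [a0 [a1 [a01 ca0 ca1]]] [b0 [b1 [b01 cb0 cb1]]]] ckE] := ck.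
set A := posset c in pP pT pp; set B := posset (opp c) in pP pT pp.
have [a0A a1A] : a0 \in A /\ a1 \in A by rewrite !inE.
have [b0B b1B] : b0 \in B /\ b1 \in B by rewrite !posset_opp.
have other (A' : {set I}) (i x y : I) : x != y -> x \in A' -> y \in A' ->
  exists2 z, z \in A' & i != z.
  move=> xy xA yA; have [ix|] := eqVneq i x; last by exists x.
  by exists y => //; rewrite ix.
pose f i := if i \in A then p i b0 else p a0 b0.
have [|Y XY] := @generating_translates _ _ P I f k 0 genP.
  (* 0 belongs to X. Indices outside A repeat the translate of a0, so that the family is indexed by
     I. *)
  by move=> j; rewrite add0r /f; case: ifP => [jA|_];
    [case: (pP j b0)|case: (pP a0 b0)].
have [z zk zh] := fs_facet fsP k.
have Pz : P z.
  by apply/(fs_mem fsP) => i; have [->|/zh/ltW//] := eqVneq i k; rewrite zk.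
have [x xX [y yY zE]] : minkowski_sum [set x | forall j,
  P (x + f j)]%classic Y z.
  by rewrite XY.
have XYP x' : (forall j, P (x' + f j)) -> P (x' + y).
  by move=> x'X; rewrite -XY; exists x' => //; exists y.
(* Expand u_k on A: for each i in A some a != i puts p a b0 on facet i, so u_i x <= 0. *)
have xk : dot (u k) x <= 0.
  rewrite (dot_center _ ckE) sumr_le0 // => i iA.
  have [a aA ia] := other A i a0 a1 a01 a0A a1A.
  have ci : 0 < c i by move: iA; rewrite inE.
  rewrite pmulr_rle0 //; have := P_le i (xX a).
  by rewrite /f aA dotDr pT ?gerDr // finset.in_setU finset.in_setD1 ia iA.
(* Expand u_k on B: for each j in B choose b != j, so that p a0 b is on facet j; adding p a0 b - p
   a0 b0 to y then bounds u_j y by u_j (p a0 b0). *)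
have yk : dot (u k) y <= h k - e.
  have [_ <-] := pP a0 b0 a0A b0B; rewrite !(dot_center _ ckE') ler_sum // =>
    j jB.
  have [b bB jb] := other B j b0 b1 b01 b0B b1B.
  have cj : 0 < opp c j by move: jB; rewrite inE.
  rewrite ler_pM2l //.
  have /(P_le j) : P (p a0 b - p a0 b0 + y).
    apply: XYP => i; rewrite /f; case: ifP => [iA|_].
      rewrite addrAC [p a0 b + _]addrC (pp i b0 a0 b) // addrK.
      by have [] := pP i b iA bB.
    by rewrite subrK; have [] := pP a0 b a0A bB.
  rewrite dotDr dotBr (pT a0 b) //; first lra.
  by rewrite finset.in_setU !finset.in_setD1 jb jB orbT.
by move: zk; rewrite -zE dotDr; lra.
Qed.

End Core.

(** * Sign vectors of the arrangement *)

Section Signs.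
Variables (R : realType) (n : nat) (I : finType).
Local Notation V := 'rV[R]_n.
Variable (u : I -> V).
Implicit Types (c d g s : I -> R).

(* Moving along a dependency supported in the support of c until a first      *)
(* coefficient vanishes keeps the sign conditions and shrinks the support.    *)
Lemma conformal_circuit g s c : comb u c = 0 -> (exists i, c i != 0) ->
    (forall i, c i * s i <= 0) -> \sum_i c i * g i <= 0 ->
  exists d, [/\ circuit u d, exists i, d i != 0, forall i, d i * s i <= 0 &
    \sum_i d i * g i <= 0].
Proof.
have [N] := ubnP #|[set i | c i != 0]|.
elim: N c => // N IHN c leN c0 [i0 ci0] cs cg.
have [cc|] := pselect (circuit u c); first by exists c; split=> //; exists i0.
move=> /not_andP[//|/existsNP[d /not_implyP[dc /not_implyP[d0 /forallNP dN]]]].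
have [d1 [d10 d1c d1i0 [i1 d1i1] d1g]] : exists d1, [/\ comb u d1 = 0,
    forall i, c i = 0 -> d1 i = 0, d1 i0 = 0, exists i, d1 i != 0 &
    \sum_i d1 i * g i <= 0].
  pose d1 i := d i - d i0 / c i0 * c i.
  have d10 : comb u d1 = 0.
    by rewrite (combB u d (fun i => d i0 / c i0 * c i))
      combZ d0 c0 scaler0 subrr.
  have d1c i : c i = 0 -> d1 i = 0 by move=> ci;
    rewrite /d1 dc // ci mulr0 subrr.
  have d1i0 : d1 i0 = 0 by rewrite /d1 divfK ?subrr.
  have [i1 d1i1] : exists i, d1 i != 0.
    apply: contrapT => /forallNP d1N; apply: (dN (d i0 / c i0)) => i.
    by have /negP := d1N i; rewrite negbK subr_eq0 => /eqP.
  have [d1g|d1g] := leP (\sum_i d1 i * g i) 0.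
    by exists d1; split=> //; exists i1.
  exists (fun i => - d1 i); split.
  - by rewrite combN d10 oppr0.
  - by move=> i /d1c ->; rewrite oppr0.
  - by rewrite d1i0 oppr0.
  - by exists i1; rewrite oppr_eq0.
  - rewrite (eq_bigr (fun i => - (d1 i * g i))); last by move=> i _;
      rewrite mulNr.
    by rewrite sumrN oppr_le0 ltW.
have lt_supp (e : I -> R) j : (forall i, c i = 0 -> e i = 0) -> e j = 0 ->
  c j != 0 ->
    (#|[set i | e i != 0%R]| < N)%N.
  move=> ec ej cj; rewrite -ltnS (leq_trans _ leN) // ltnS; apply: proper_card.
  apply/properP; split.
    by apply/fintype.subsetP => i; rewrite !inE; apply: contraNN => /eqP/ec ->.
  by exists j; rewrite !inE ?ej ?eqxx.
have [d1s|] := pselect (forall i, d1 i * s i <= 0).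
  by apply: (IHN d1) => //; [exact: (lt_supp _ i0)|exists i1].
move=> /existsNP[i2 /negP]; rewrite -ltNge => i2s.
pose t i := - c i / d1 i.
have [i i_s tP] : exists2 i, 0 < d1 i * s i & forall j, 0 < d1 j * s j ->
  t i <= t j.
  by case: (Order.TotalTheory.arg_minP t (P := fun i => 0 < d1 i * s i) i2s) =>
    i; exists i.
have tE j : 0 < d1 j * s j -> t j = - (c j * s j) / (d1 j * s j).
  move=> js; rewrite /t; field.
  by have := gt_eqF js; rewrite mulf_eq0 => /negbT/norP[-> ->].
have d1i : d1 i != 0 by apply: contraTneq i_s => ->; rewrite mul0r ltxx.
have ci : c i != 0 by apply: contraNneq d1i => /d1c ->.
have t0 : 0 <= t i by rewrite tE // divr_ge0 ?oppr_ge0 // ltW.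
apply: (IHN (fun j => c j + t i * d1 j)).
- apply: (lt_supp _ i) => // [j cj|]; first by rewrite cj d1c // mulr0 addr0.
  by rewrite /t divfK // subrr.
- by rewrite (combD u c (fun j => t i * d1 j)) combZ c0 d10 scaler0 addr0.
- by exists i0; rewrite d1i0 mulr0 addr0.
- move=> j; rewrite mulrDl -mulrA; have [js|js] := ltrP 0 (d1 j * s j);
    last first.
    by rewrite -[leRHS]addr0 lerD // mulr_ge0_le0.
  have := tP j js; rewrite [t j]tE // ler_pdivlMr //; lra.
- rewrite (eq_bigr (fun j => c j * g j + t i * (d1 j * g j)));
    last by move=> j _; ring.
  by rewrite big_split /= -mulr_sumr -[leRHS]addr0 lerD // mulr_ge0_le0.
Qed.

(** For a dependency, h_i may be replaced by the slack h_i - u_i z at any z. Take z relatively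
    interior to the facet of the negative coefficient, or interior to P if there is none: no term is
    negative, and some term is positive. *)
Lemma circuit_sum_gt0 (P : set V) (h c : I -> R) : facet_system P u h ->
    comb u c = 0 -> (exists i, c i != 0) ->
    (forall i j, c i < 0 -> c j < 0 -> i = j) ->
  0 < \sum_i c i * h i.
Proof.
move=> fsP c0 [i0 ci0] cneg.
have sumE z : \sum_i c i * h i = \sum_i c i * (h i - dot (u i) z).
  rewrite [RHS](eq_bigr (fun i => c i * h i - c i * dot (u i) z)); last first.
    by move=> i _; rewrite mulrBr.
  by rewrite sumrB -dot_comb c0 dot0l subr0.
suff [z [i [ci zi z0]]] : exists z i, [/\ c i != 0, dot (u i)
  z < h i & forall j,
    dot (u j) z = h j \/ dot (u j) z < h j /\ 0 <= c j].
  have z0' j : 0 <= c j * (h j - dot (u j) z).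
    have [->|[jz cj]] := z0 j; first by rewrite subrr mulr0.
    by rewrite mulr_ge0 // subr_ge0 ltW.
  rewrite (sumE z) lt_def sumr_ge0 // andbT psumr_eq0 //; apply/allPn; exists i.
    by rewrite mem_index_enum.
  by rewrite mulf_neq0 // subr_eq0 gt_eqF.
have [[j cj]|/forallNP noneg] := pselect (exists j, c j < 0); last first.
  have [z zlt] := fs_interior fsP; exists z, i0; split=> // j; right;
    split=> //.
  by rewrite leNgt; apply/negP.
have [z zj zlt] := fs_facet fsP j.
have [i ij ci] : exists2 i, i != j & c i != 0.
  apply: contrapT => /forall2NP cN; have : comb u c = c j *: u j.
    rewrite /comb (bigD1 j) //= big1 ?addr0 // => i ij.
    have [//|/negP] := cN i; rewrite negbK => /eqP ->; exact: scale0r.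
  rewrite c0 => /esym/eqP; rewrite scaler_eq0 (lt_eqF cj) /= => /eqP uj.
  by have := fs_unit fsP j; rewrite uj dot0l => /esym/eqP; rewrite oner_eq0.
exists z, i; split=> // [|l]; first exact: zlt.
have [->|lj] := eqVneq l j; [by left|right; split; first exact: zlt].
by rewrite leNgt; apply/negP => cl; move: lj; rewrite (cneg l j) ?eqxx.
Qed.

(** * Transfer of a sign vector to another right-hand side *)

Section Transfer.
Variables (P Q : set V) (h h' : I -> R) (x : V).
Hypothesis fsP : facet_system P u h.
Hypothesis fsQ : facet_system Q u h'.
Hypothesis nobad : forall c, ~ bad_circuit u c.

Let s i := Num.sg (dot (u i) x - h i).

(** Reduce c to a circuit d. Evaluation at x gives sum d h >= 0, while sum d h' <= 0. As d is not
    bad, [circuit_sum_gt0] refutes the second inequality if d has at most one negative coefficient,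
    and the first, through - d, otherwise. *)
Lemma no_certificate c : comb u c = 0 -> (forall i, c i * s i <= 0) ->
  \sum_i c i * h' i <= 0 -> forall i, c i = 0.
Proof.
move=> c0 cs ch i; apply/eqP/contraT => ci.
have [|d [dc dN ds dh]] := conformal_circuit c0 _ cs ch; first by exists i.
have [d0 _] := dc.
have dh0 : 0 <= \sum_i d i * h i.
  have : \sum_i d i * (dot (u i) x - h i) <= 0.
    apply: sumr_le0 => j _; rewrite (numEsg (dot (u j) x - h j)) mulrA.
    by rewrite mulr_le0_ge0 // ds.
  rewrite (eq_bigr (fun i => d i * dot (u i) x - d i * h i)); last first.
    by move=> j _; rewrite mulrBr.
  by rewrite sumrB -dot_comb d0 dot0l sub0r oppr_le0.
have [dneg|] := pselect (forall i j, d i < 0 -> d j < 0 -> i = j).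
  by have := circuit_sum_gt0 fsQ d0 dN dneg; rewrite ltNge dh.
move=> /existsNP[a /existsNP[b /not_implyP[da /not_implyP[db /eqP ab]]]].
have [dpos|] := pselect (forall i j, 0 < d i -> 0 < d j -> i = j).
  have : 0 < \sum_i - d i * h i.
    apply: (circuit_sum_gt0 fsP); first by rewrite combN d0 oppr0.
      by have [j dj] := dN; exists j; rewrite oppr_eq0.
    by move=> i' j'; rewrite !oppr_lt0; exact: dpos.
  rewrite (eq_bigr (fun i => - (d i * h i))); last by move=> j _; rewrite mulNr.
  by rewrite sumrN oppr_gt0 ltNge dh0.
move=> /existsNP[a' /existsNP[b' /not_implyP[da' /not_implyP[db' /eqP ab']]]].
by case: (nobad (c := d)); split=> //; [exists a', b'|exists a, b].
Qed.

(* The second component homogenizes the affine functions dot (u i) - h' i. *)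
Let E : lmodType R := (V * R^o)%type.
Let f i (z : E) := dot (u i) z.1 - h' i * z.2.

Let f_functional i : functional (f i).
Proof. by move=> a y z; rewrite /f /= dotDr dotZr /GRing.scale /=; ring. Qed.

Let cone (z : E) := [/\ forall i, 0 <= s i * f i z, forall i, s i = 0 ->
  f i z = 0 &
  0 <= z.2].

(** Otherwise Farkas' lemma would give a d for which c + d is a certificate excluded by
    [no_certificate]; so c + d = 0, which contradicts the strictness assumed of r or c. *)
Lemma strict_point c r : (forall i, c i * s i <= 0) -> 0 <= r ->
    0 < r \/ (exists i, c i * s i < 0) ->
  exists2 z, cone z & 0 < r * z.2 - \sum_i c i * f i z.
Proof.
move=> cs r0 rc; apply: contrapT => /forall2NP noz.
pose J : finType := ((I * bool) + unit)%type.
pose F (j : J) (z : E) := if j is inl (i, b) then (-1) ^+ b * f i z else - z.2.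
(* Both signs of f i are kept exactly when s i = 0, which encodes the equation f i z = 0. *)
pose T := [set j : J | if j is inl (i, b) then 0 <= (-1)
  ^+ b.+1 * s i else true].
have Ff j : functional (F j).
  case: j => [[i b]|[]] a y z; first by rewrite /= f_functional; ring.
  by rewrite /= /GRing.scale /=; ring.
have [||z zT|l [l0 lT lE]] := @farkas_set R E J T F (fun z =>
  r * z.2 - \sum_i c i * f i z).
- exact: Ff.
- move=> a y z; rewrite /= {1}/GRing.scale /= mulrDr mulrCA.
  rewrite (eq_bigr (fun i => a * (c i * f i y) + c i * f i z)); last first.
    by move=> i _; rewrite f_functional; ring.
  by rewrite big_split /= -mulr_sumr; ring.
- have [zN|/negP] := noz z; last by rewrite -leNgt.
  case: zN; have fle i : 0 <= - s i -> f i z <= 0.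
    move=> si; have := zT (inl (i, false)); rewrite inE /= expr1 mulN1r =>
      /(_ si).
    by rewrite expr0 mul1r.
  have fge i : 0 <= s i -> 0 <= f i z.
    move=> si; have := zT (inl (i, true)); rewrite inE /= expr2 mulN1r opprK
      mul1r => /(_ si).
    by rewrite expr1 mulN1r oppr_le0.
  split=> [i|i si|].
  + have [si|si] := leP 0 (s i); first by rewrite mulr_ge0 // fge.
    by rewrite mulr_le0 ?(ltW si) // fle // oppr_ge0 ltW.
  + by apply/eqP; rewrite eq_le fle ?fge // si ?oppr0.
  + by have := zT (inr tt); rewrite inE oppr_le0; exact.
pose d i := l (inl (i, false)) - l (inl (i, true)).
have {}lE z : (r + l (inr tt)) * z.2 = \sum_i (c i + d i) * f i z.
  have := lE z; rewrite big_sumType /= (bigD1 tt) //= big_pred0_eq addr0.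
  rewrite mulrN => H.
  have -> : \sum_i (c i + d i) * f i z = \sum_i c i * f i z + \sum_i d i * f i
    z.
    by rewrite -big_split; apply: eq_bigr => i _; rewrite mulrDl.
  suff -> : \sum_i d i * f i z = \sum_(p : I * bool) l (inl p) * F (inl p) z.
    by move: H; lra.
  rewrite [RHS](eq_bigr (fun p => l (inl (p.1, p.2)) * F (inl (p.1, p.2)) z));
    last by case.
  rewrite -(pair_bigA _ (fun i b => l (inl (i, b)) * F (inl (i, b)) z)) /=.
  apply: eq_bigr => i _; rewrite (bigD1 true) //= (bigD1 false) //= big_pred0;
    last by case.
  rewrite /d expr0 expr1; ring.
have dle i : d i * s i <= 0.
  have lb b : (l (inl (i, b)) * ((-1) ^+ b * s i)) <= 0.
    have [|] := boolP (inl (i, b) \in T); last by move=> /lT ->; rewrite mul0r.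
    rewrite inE exprS mulN1r mulNr oppr_ge0 => H; exact: mulr_ge0_le0.
  by move: (lb true) (lb false); rewrite /d expr0 expr1; lra.
have comb0 : comb u (fun i => c i + d i) = 0.
  apply: eq_dot => y; rewrite dot0l dot_comb; have := lE (y, 0).
  rewrite /f /= mulr0 => H; rewrite [RHS]H; apply: eq_bigr => i _.
  by rewrite mulr0 subr0.
have sumh : \sum_i (c i + d i) * h' i = - (r + l (inr tt)).
  have := lE (0, 1); rewrite /f /= mulr1 => ->; rewrite -sumrN;
    apply: eq_bigr => i _.
  by rewrite dot0r mulr1 sub0r mulrN opprK.
have cd0 : forall i, c i + d i = 0.
  apply: no_certificate => //; last by rewrite sumh oppr_le0 addr_ge0.
  by move=> i; rewrite mulrDl -[leRHS]addr0 lerD.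
case: rc => [rgt|[i ci]].
  have : 0 < r + l (inr tt) by rewrite ltr_wpDr.
  by rewrite -oppr_lt0 -sumh big1 ?ltxx // => i _; rewrite cd0 mul0r.
have : (c i + d i) * s i < 0 by rewrite mulrDl -[ltRHS]addr0 ltr_leD.
by rewrite cd0 mul0r ltxx.
Qed.

(** The closed cone is convex. Sum one of its points with positive last coordinate and, for each i
    with s i != 0, one where the i-th condition is strict; the sum is strict everywhere, and
    dividing by its last coordinate gives x'. *)
Lemma same_signs : exists x', forall i, Num.sg (dot (u i) x' - h' i) = s i.
Proof.
have coneD z z' : cone z -> cone z' -> cone (z + z').
  move=> [z1 z2 z3] [z1' z2' z3']; split=> [i|i si|]; last exact: addr_ge0.
    by rewrite (functionalD _ _ (f_functional i)) mulrDr addr_ge0.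
  by rewrite (functionalD _ _ (f_functional i)) z2 // z2' // addr0.
have cone0 : cone 0.
  by split=> [i|i _|//]; rewrite (functional0 (f_functional i)) ?mulr0.
have [z0 z0c z0r] : exists2 z, cone z & 0 < z.2.
  have [|||z zc] := @strict_point (fun=> 0) 1.
  - by move=> i; rewrite mul0r.
  - exact: ler01.
  - by left.
  by rewrite big1 ?subr0 ?mul1r => [|i _]; [exists z|rewrite mul0r].
have /choice[z zP] : forall i, exists z, cone z /\ (s i != 0 ->
  0 < s i * f i z).
  move=> i; have [si|si] := eqVneq (s i) 0; first by exists 0.
  have [|||z zc zlt] := @strict_point (fun j => if j == i then - s i else 0) 0.
  - move=> j; case: eqP => [->|_]; last by rewrite mul0r.
    by rewrite mulNr oppr_le0 -expr2 sqr_ge0.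
  - by [].
  - right; exists i; rewrite eqxx mulNr oppr_lt0 -expr2 lt_def sqr_ge0 andbT.
    by rewrite expf_neq0.
  exists z; split=> // _; move: zlt; rewrite mul0r sub0r (bigD1 i) //= eqxx.
  by rewrite big1 ?addr0 ?mulNr ?opprK // => j /negPf ->; rewrite mul0r.
pose y := z0 + \sum_i z i.
have sumc (p : pred I) : cone (\sum_(i | p i) z i).
  by apply: big_ind => [|z1 z2|i _]; [exact: cone0|exact: coneD|have []
    := zP i].
have yc : cone y by apply: coneD => //; exact: sumc.
have [y1 y2 y3] := yc.
have [_ _ sum2] := sumc xpredT.
have yr : 0 < y.2.
  have -> : y.2 = z0.2 + (\sum_i z i).2 by [].
  exact: ltr_wpDr.
have ys i : s i != 0 -> 0 < s i * f i y.
  move=> si; have [_ /(_ si) zi] := zP i.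
  rewrite /y (bigD1 i) //= [z i + _]addrC addrA (functionalD _ _ (f_functional
    i)) mulrDr ltr_wpDl //.
  have [H _ _] : cone (z0 + \sum_(j | j != i) z j).
    by apply: coneD => //; exact: sumc.
  exact: H.
exists (y.2^-1 *: y.1) => i.
have -> : dot (u i) (y.2^-1 *: y.1) - h' i = y.2^-1 * f i y.
  by rewrite dotZr /f mulrBr mulrCA mulVf ?mulr1 // gt_eqF.
rewrite sgrM gtr0_sg ?invr_gt0 // mul1r.
have [si|si] := eqVneq (s i) 0; first by rewrite y2 // si sgr0.
have := ys i si; rewrite /s; case: (ltrgtP (dot (u i) x - h i) 0) => [lt|gt|->].
- by rewrite ltr0_sg // mulN1r oppr_gt0 => ?; rewrite ltr0_sg.
- by rewrite gtr0_sg // mul1r => ?; rewrite gtr0_sg.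
- by rewrite sgr0 mul0r ltxx.
Qed.

End Transfer.
End Signs.

Local Open Scope classical_set_scope.
Local Open Scope ring_scope.

(** * Cells of the arrangement *)

Section Cells.
Variables (R : realType) (n : nat) (I : finType).
Local Notation V := 'rV[R]_n.

Definition hyperplanes (u : I -> V) (h : I -> R) : set (set V) :=
  [set H | exists i, H = [set y | dot (u i) y = h i]].

Variables (u : I -> V) (h : I -> R).

Definition sgn (x : V) i : R := Num.sg (dot (u i) x - h i).

Lemma sg_convex (a b s : R) : Num.sg a = Num.sg b -> 0 <= s <= 1 ->
  Num.sg ((1 - s) * a + s * b) = Num.sg a.
Proof.
move=> ab /andP[s0 s1]; case: (ltrgtP a 0) ab => [a0|a0|->].
- rewrite (ltr0_sg a0) => /esym/eqP; rewrite sgr_cp0 => b0.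
  by rewrite ltr0_sg //; nra.
- rewrite (gtr0_sg a0) => /esym/eqP; rewrite sgr_cp0 => b0.
  by rewrite gtr0_sg //; nra.
- by rewrite sgr0 => /esym/eqP; rewrite sgr_eq0 => /eqP ->;
    rewrite !mulr0 addr0 sgr0.
Qed.

Lemma same_positionP i x y :
  same_position [set y | dot (u i) y = h i] x y <-> sgn x i = sgn y i.
Proof.
have E s : dot (u i) ((1 - s) *: x + s *: y) - h i
    = (1 - s) * (dot (u i) x - h i) + s * (dot (u i) y - h i).
  by rewrite dotDr !dotZr; ring.
rewrite /same_position /sgn /=; split=> [[[-> ->]//|seg]|sxy].
  set a := dot (u i) x - h i in E *; set b := dot (u i) y - h i in E *.
  have noz s : 0 <= s -> s <= 1 -> (1 - s) * a + s * b != 0.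
    by move=> s0 s1; rewrite -E subr_eq0; apply/eqP/seg; rewrite s0.
  have a0 : a != 0 by have := noz 0 (lexx _) ler01;
    rewrite subr0 mul1r mul0r addr0.
  have b0 : b != 0 by have := noz 1 ler01 (lexx _);
    rewrite subrr mul1r mul0r add0r.
  (* If the signs were opposite, the segment would meet the hyperplane at parameter a / (a - b). *)
  have root : a - b != 0 -> (1 - a / (a - b)) * a + a / (a - b) * b = 0.
    by move=> ab; field.
  have [alt|agt] := ltrP a 0; have [blt|bgt] := ltrP b 0.
  - by rewrite !ltr0_sg.
  - have ab : a - b < 0 by lra.
    have z0 : 0 <= a / (a - b) by rewrite ler_ndivlMr // mul0r ltW.
    have z1 : a / (a - b) <= 1 by rewrite ler_ndivrMr //; lra.
    by have := noz _ z0 z1; rewrite root ?eqxx // lt_eqF.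
  - have {}agt : 0 < a by rewrite lt_def a0.
    have ab : 0 < a - b by lra.
    have z0 : 0 <= a / (a - b) by rewrite ler_pdivlMr // mul0r ltW.
    have z1 : a / (a - b) <= 1 by rewrite ler_pdivrMr //; lra.
    by have := noz _ z0 z1; rewrite root ?eqxx // gt_eqF.
  - by rewrite !gtr0_sg // lt_def ?a0 ?b0.
have [x0|x0] := eqVneq (dot (u i) x) (h i).
  left; split=> //; move: sxy; rewrite x0 subrr sgr0 => /esym/eqP.
  by rewrite sgr_eq0 subr_eq0 => /eqP.
right=> s s01 /eqP; rewrite -subr_eq0 E -sgr_eq0 sg_convex // sgr_eq0 subr_eq0.
by rewrite (negPf x0).
Qed.

Lemma dot_continuous (w : V) : continuous (dot w).
Proof.
apply: continuous_big => [|i _]; first exact: add_continuous.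
move=> x; apply: continuousM; first exact: cst_continuous.
exact: coord_continuous.
Qed.

(** Nonzero signs persist near y. Conversely, any step from y towards x, however short, turns the
    zero signs of y into those of x. *)
Lemma cell_closure x :
  closure [set y | forall H, hyperplanes u h H -> same_position H x y]
  = [set y | forall i, sgn y i = 0 \/ sgn y i = sgn x i].
Proof.
apply/seteqP; split=> y /= yx.
  move=> i; have [y0|y0] := eqVneq (sgn y i) 0; [by left|right].
  have dy0 : dot (u i) y - h i != 0 by rewrite -sgr_eq0.
  have [|z [zx /= zy]] := yx [set z | `|dot (u i) y - dot (u i) z| < `|dot (u i)
    y - h i|].
    have /cvgrPdist_lt/(_ `|dot (u i) y - h i|) := @dot_continuous (u i) y.
    by apply; rewrite normr_gt0.
  have [->] : sgn x i = sgn z i by apply/same_positionP; apply: zx; exists i.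
  move: zy; rewrite /sgn; set a := dot _ y; set b := dot _ z.
  case: (ltrgtP (a - h i) 0) dy0 => // [a0|a0] _; rewrite ltr_norml => /andP[].
    by rewrite ltr0_norm // => H1 H2; rewrite !ltr0_sg //; lra.
  by rewrite gtr0_norm // => H1 H2; rewrite !gtr0_sg //; lra.
move=> B /nbhs_ballP[e /= e0 eB].
pose t := e / (e + `|y - x|).
have et : 0 < e + `|y - x| by rewrite ltr_wpDr.
have t0 : 0 < t by rewrite divr_gt0.
have t1 : t <= 1 by rewrite ler_pdivrMr // mul1r lerDl.
exists ((1 - t) *: y + t *: x); split.
  move=> H [i ->]; apply/same_positionP; rewrite /sgn.
  have -> : dot (u i) ((1 - t) *: y + t *: x) - h i
      = (1 - t) * (dot (u i) y - h i) + t * (dot (u i) x - h i).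
    by rewrite dotDr !dotZr; ring.
  have [/eqP|yxi] := yx i; last by rewrite sg_convex // (ltW t0).
  by rewrite sgr_eq0 => /eqP ->; rewrite mulr0 add0r sgrM (gtr0_sg t0) mul1r.
apply: eB; rewrite -ball_normE /=.
have -> : y - ((1 - t) *: y + t *: x) = t *: (y - x).
  by rewrite scalerBl scale1r scalerBr opprD opprB addrA addrCA subrr addr0.
rewrite normrZ gtr0_norm // /t mulrAC ltr_pdivrMr // ltr_pM2l //.
by rewrite ltrDr.
Qed.

End Cells.

Section CellIso.
Variables (R : realType) (n : nat) (I : finType).
Local Notation V := 'rV[R]_n.

(** Inclusion of closed cells is a relation between their sign vectors, so two arrangements with the
    same sign vectors have isomorphic posets of cells. *)
Lemma cells_isomorphic (u : I -> V) (h h' : I -> R) :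
    (forall x, exists x', forall i, sgn u h' x' i = sgn u h x i) ->
    (forall x, exists x', forall i, sgn u h x' i = sgn u h' x i) ->
  inclusion_isomorphic (arrangement_cells (hyperplanes u h))
                       (arrangement_cells (hyperplanes u h')).
Proof.
move=> hh' h'h.
pose cell g x := [set y : V | forall i, sgn u g y i = 0 \/ sgn u g y i
  = sgn u g x i].
have cellsE g : arrangement_cells (hyperplanes u g)
  = [set cell g x | x in [set: V]].
  by apply/seteqP; split=> A /= [x _ <-]; exists x; rewrite // cell_closure.
have cell_refl g x : cell g x x by move=> i; right.
have cell_sub g x y : cell g x `<=` cell g y <->
    forall i, sgn u g x i = 0 \/ sgn u g x i = sgn u g y i.
  split=> [xy|xy z zx i]; first exact: xy.
  by have [z0|zx'] := zx i; [left|rewrite zx'].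
pose phi (A : set V) := [set z' | exists2 z, A z & forall i,
  sgn u h' z' i = sgn u h z i].
have phiE x x' : (forall i, sgn u h' x' i = sgn u h x i) -> phi (cell h x)
  = cell h' x'.
  move=> xx'; apply/seteqP; split=> z' /=.
    by move=> [z zx zz'] i; rewrite zz' xx'.
  move=> z'x'; have [z zz'] := h'h z'; exists z => // i.
  by rewrite zz' -xx'.
have mono A B : [set cell h x | x in [set: V]] A ->
  [set cell h x | x in [set: V]] B ->
    (A `<=` B <-> phi A `<=` phi B).
  move=> [x _ <-] [y _ <-]; have [x' xx'] := hh' x; have [y' yy'] := hh' y.
  rewrite (phiE x x') // (phiE y y') //.
  by split=> /cell_sub H; apply/cell_sub => i; move: (H i); rewrite xx' yy'.
rewrite !cellsE; exists phi; last exact: mono.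
split=> [A /= [x _ <-]|A B|A /= [x' _ <-]].
- by have [x' xx'] := hh' x; exists x' => //; rewrite (phiE x x').
- rewrite !inE => FA FB AB; apply/seteqP.
  by split; apply/mono => //; rewrite AB.
- have [x xx'] := h'h x'; exists (cell h x); first by exists x.
  exact: phiE.
Qed.

End CellIso.

(** * Facets *)

Section Affine.
Variables (R : realType) (n : nat).
Local Notation V := 'rV[R]_n.
Implicit Types (A : set V) (x y w : V) (W : {vspace V}).

Lemma sub_aff_hull A : A `<=` aff_hull A.
Proof.
move=> x Ax; exists 1, (fun=> x), (fun=> 1); split=> //.
  by rewrite big_ord1.
by rewrite big_ord1 scale1r.
Qed.

Lemma aff_hull_line A x y (s : R) :
  A x -> A y -> aff_hull A ((1 - s) *: x + s *: y).
Proof.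
move=> Ax Ay; exists 2, (fun i : 'I_2 => if i == ord0 then x else y),
  (fun i : 'I_2 => if i == ord0 then 1 - s else s); split.
- by move=> i; case: ifP.
- by rewrite !big_ord_recl big_ord0 /= addr0 subrK.
- by rewrite !big_ord_recl big_ord0 /= addr0.
Qed.

Lemma aff_hull_sub A w c : A `<=` [set y | dot w y = c] ->
  aff_hull A `<=` [set y | dot w y = c].
Proof.
move=> Aw _ [k [v [l [Av l1 ->]]]] /=; rewrite dot_sumr.
rewrite (eq_bigr (fun i => l i * c)); last by move=> i _;
  rewrite dotZr (Aw _ (Av i)).
by rewrite -mulr_suml l1 mul1r.
Qed.

Lemma aff_hull_neq0 A x : aff_hull A x -> exists y, A y.
Proof.
move=> [[|k] [v [l [Av l1 _]]]]; last by exists (v ord0).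
by move: l1; rewrite big_ord0 => /esym/eqP; rewrite oner_eq0.
Qed.

Lemma coset_inj x x' W W' :
  [set y | y - x \in W] = [set y | y - x' \in W'] -> W = W'.
Proof.
move=> E; have xx' : x - x' \in W'.
  have : [set y | y - x \in W] x by rewrite /= subrr mem0v.
  by rewrite E.
apply/vspaceP => z; have /= : [set y | y - x \in W] (z + x)
  = [set y | y - x' \in W'] (z + x).
  by rewrite E.
rewrite addrK -addrA => H; apply/idP/idP => [zW|zW'].
  have : z + (x - x') \in W' by rewrite -H.
  by move=> /(memvB)/(_ xx'); rewrite addrK.
by rewrite H memvD.
Qed.

Lemma has_dim_inj A d d' : has_dim A d -> has_dim A d' -> d = d'.
Proof.
move=> [x [W [<- AW]]] [x' [W' [<- AW']]]; congr (\dim _).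
by apply: (@coset_inj x x'); rewrite -AW -AW'.
Qed.

Lemma dimv_rV : \dim (fullv : {vspace V}) = n.
Proof. by rewrite dimvf dim_matrix mul1r. Qed.

Lemma has_dim_full A : has_dim A n <-> aff_hull A = setT.
Proof.
split=> [[x [W [dW ->]]]|AT].
  have -> : W = fullv by apply/eqP; rewrite eqEdim subvf dimv_rV dW /=.
  by apply/seteqP; split=> // y _ /=; rewrite memvf.
exists 0, fullv; rewrite dimv_rV AT; split=> //.
by apply/seteqP; split=> // y _ /=; rewrite memvf.
Qed.

Lemma orthogonal_vspace w : w != 0 -> exists W,
  (\dim W).+1 = n /\ forall y, (y \in W) = (dot w y == 0).
Proof.
move=> w0; pose f := linfun (mulmxr w^T : 'rV[R]_n -> 'M[R]_(1, 1)).
have fE y : f y = (dot w y)%:M.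
  rewrite lfunE /=; apply/matrixP => i j; rewrite !ord1 !mxE eqxx mulr1n.
  by apply: eq_bigr => l _; rewrite !mxE mulrC.
exists (lker f); split; last first.
  move=> y; rewrite memv_ker fE; apply/eqP/eqP => [/matrixP/(_ 0 0)|->].
    by rewrite !mxE eqxx mulr1n.
  by rewrite raddf0.
have dimE : (\dim (lker f) + \dim (limg f))%N = n.
  by have := limg_ker_dim f fullv; rewrite capfv dimv_rV.
apply: etrans dimE; rewrite -addn1; congr (_ + _)%N; apply/esym/eqP;
  rewrite eqn_leq.
rewrite (leq_trans (dimvS (subvf _))) ?dimvf ?dim_matrix ?mul1r //=.
rewrite lt0n dimv_eq0; apply/negP => /eqP lim0.
have : f w \in limg f by rewrite memv_img ?memvf.
rewrite lim0 memv0 fE => /eqP/matrixP/(_ 0 0); rewrite !mxE eqxx mulr1n => /eqP.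
by rewrite dot_eq0 (negPf w0).
Qed.

Lemma parallel_of_orthogonal w u : dot u u = 1 ->
  (forall y, dot u y = 0 -> dot w y = 0) -> w = dot w u *: u.
Proof.
move=> uu uw; set s := dot w u.
have z : dot u (w - s *: u) = 0 by rewrite dotBr dotZr uu mulr1 dotC subrr.
apply/eqP; rewrite -subr_eq0 -dot_eq0 dotBl uw // dotZl z mulr0 subrr //.
Qed.

(** The average of y and all the z_i; y keeps it meaningful when I is empty. *)
Lemma average_strict (I : finType) (a : I -> V) (b : I -> R) (y : V)
    (z : I -> V) :
    (forall i, dot (a i) y <= b i) -> (forall i j, dot (a i) (z j) <= b i) ->
    (forall i, dot (a i) (z i) < b i) ->
  exists2 m, forall i, dot (a i) m < b i &
    forall w c, dot w y = c -> (forall i, dot w (z i) = c) -> dot w m = c.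
Proof.
move=> yle zle zlt; pose N : R := #|I|%:R + 1.
have N0 : 0 < N by rewrite ltr_wpDl.
exists (N^-1 *: (y + \sum_i z i)) => [i|w c wy wz].
  rewrite dotZr mulrC ltr_pdivrMr // dotDr dot_sumr (bigD1 i) //=.
  have : \sum_(j | j != i) dot (a i) (z j) <= \sum_(j | j != i)
    b i by apply: ler_sum.
  have : \sum_(j : I) b i = b i * #|I|%:R by rewrite mulr_natr sumr_const.
  rewrite (bigD1 i) //= => bE; move: (zlt i) (yle i).
  by rewrite /N; lra.
rewrite dotZr dotDr dot_sumr wy (eq_bigr (fun=> c)) // sumr_const.
rewrite -mulr_natl /N; field; exact: lt0r_neq0 N0.
Qed.

End Affine.

Section Facets.
Variables (R : realType) (n : nat) (I : finType).
Local Notation V := 'rV[R]_n.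
Variables (P : set V) (u : I -> V) (h : I -> R).
Hypothesis fsP : facet_system P u h.
Hypothesis dimP : has_dim P n.

Let H i := [set y : V | dot (u i) y = h i].

Lemma move_inside x w : (forall i, dot (u i) x < h i) ->
  exists2 e, 0 < e & P (x + e *: w).
Proof.
move=> xlt; have [|e e0 eP] := @exists_lb_gt0 R I (fun i => 0 < dot (u i) w)
    (fun i => (h i - dot (u i) x) / dot (u i) w).
  by move=> i wi; rewrite divr_gt0 // subr_gt0 xlt.
exists e => //; apply/(fs_mem fsP) => i; rewrite dotDr dotZr -lerBrDl.
have [wi|wi] := ltrP 0 (dot (u i) w); first by rewrite -ler_pdivlMr // eP.
by rewrite (le_trans (y := 0)) ?pmulr_rle0 // subr_ge0 ltW.
Qed.

(** From a relative interior point of the facet, a short step towards any point of the hyperplane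
    stays in P. *)
Lemma aff_hull_facet i : aff_hull (P `&` H i) = H i.
Proof.
apply/seteqP; split; first by apply: aff_hull_sub => y [].
move=> y /= yi; have [z zi zlt] := fs_facet fsP i.
have [|e e0 eP] := @exists_lb_gt0 R I (fun j => 0 < dot (u j) (y - z))
    (fun j => (h j - dot (u j) z) / dot (u j) (y - z)).
  move=> j wj; rewrite divr_gt0 // subr_gt0 zlt //.
  by apply: contraTneq wj => ->; rewrite dotBr yi zi subrr ltxx.
have Pz : P z by apply/(fs_mem fsP) => j; have [->|/zlt/ltW//] := eqVneq j i;
  rewrite zi.
have Pze : P (z + e *: (y - z)).
  apply/(fs_mem fsP) => j; rewrite dotDr dotZr -lerBrDl.
  have [wj|wj] := ltrP 0 (dot (u j) (y - z)); first
    by rewrite -ler_pdivlMr // eP.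
  by rewrite (le_trans (y := 0)) ?pmulr_rle0 // subr_ge0;
    have /(fs_mem fsP) := Pz; exact.
have -> : y = (1 - e^-1) *: z + e^-1 *: (z + e *: (y - z)).
  rewrite scalerDr scalerA mulVf ?gt_eqF // scale1r scalerBl scale1r.
  by rewrite addrA subrK addrC subrK.
apply: aff_hull_line; split=> //=; rewrite /H /=.
by rewrite dotDr dotZr dotBr yi zi subrr mulr0 addr0.
Qed.

Lemma dim_facet i : exists d, has_dim P d.+1 /\ has_dim (P `&` H i) d.
Proof.
have ui : u i != 0 by exact: unit_neq0 fsP i.
have [W [dW WE]] := orthogonal_vspace ui.
exists (\dim W); rewrite dW; split=> //.
have [z zi _] := fs_facet fsP i; exists z, W; split=> //.
rewrite aff_hull_facet; apply/seteqP; split=> y /=.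
  by rewrite WE dotBr zi => ->; rewrite subrr.
by rewrite WE dotBr zi subr_eq0 => /eqP.
Qed.

(** If no H i contained F, averaging points of F would give an interior point of P at which v is
    maximal, so v = 0. Hence F lies in some H i, and by dimension its directions fill the orthogonal
    complement of u_i, so v is parallel to u_i. *)
Lemma face_cut_facet v c F d :
    is_face_cut P v c F -> has_dim F d -> has_dim P d.+1 ->
  exists i s, [/\ 0 < s, v = s *: u i, c = s * h i & F = P `&` H i].
Proof.
move=> [vle FE] dimF dimP'; have dn : d.+1 = n := has_dim_inj dimP' dimP.
have [x [W [dW FW]]] := dimF.
have /aff_hull_neq0[y Fy] : aff_hull F x by rewrite FW /= subrr mem0v.
have Fv : F `<=` [set y | dot v y = c] by rewrite FE => z [].
have v0 : v != 0.
  apply/eqP => v0; have FP : F = P.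
    rewrite FE; apply/seteqP; split=> [z []//|z Pz]; split=> //=.
    by have := Fv _ Fy; rewrite /= v0 !dot0l.
  by move: dimF; rewrite FP => dimF'; have /n_Sn := has_dim_inj dimF' dimP'.
have [i Fi] : exists i, F `<=` H i.
  apply: contrapT => /forallNP FN.
  have /choice[z zP] : forall i, exists z, F z /\ dot (u i) z < h i.
    move=> i; apply: contrapT => /forallNP zN; apply: (FN i) => z Fz /=.
    have Pz : P z by move: Fz; rewrite FE => -[].
    apply/eqP; rewrite eq_le (P_le fsP) // leNgt /=; apply/negP => zi.
    exact: (zN z).
  have [i|i j|i|m mlt mE] := @average_strict R n I u h y z.
  - by apply: (P_le fsP); move: Fy; rewrite FE => -[].
  - by apply: (P_le fsP); have [] := zP j; rewrite FE => -[].
  - by have [] := zP i.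
  have mc : dot v m = c.
    by apply: mE => [|i]; apply: Fv => //; have [] := zP i.
  have [e e0 /vle] := move_inside v mlt.
  by rewrite dotDr dotZr mc gerDl pmulr_rle0 // leNgt dot_gt0.
have Hx : aff_hull F x by rewrite FW /= subrr mem0v.
have WF z : z \in W -> aff_hull F (x + z) by move=> zW;
  rewrite FW /= addrC addKr.
have Wv z : z \in W -> dot v z = 0.
  move=> /WF/(aff_hull_sub Fv) /=; have /= := aff_hull_sub Fv Hx.
  by rewrite dotDr => -> /eqP; rewrite -subr_eq0 addrC addKr => /eqP.
have Wu z : z \in W -> dot (u i) z = 0.
  move=> /WF/(aff_hull_sub Fi) /=; have /= := aff_hull_sub Fi Hx.
  by rewrite dotDr => -> /eqP; rewrite -subr_eq0 addrC addKr => /eqP.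
have [U [dU UE]] := orthogonal_vspace (unit_neq0 fsP i).
have WU : W = U.
  apply/eqP; rewrite eqEdim; apply/andP; split.
    by apply/subvP => z /Wu zu; rewrite UE zu.
  by rewrite -ltnS dU dW dn.
have vE : v = dot v (u i) *: u i.
  apply: parallel_of_orthogonal; first exact: fs_unit fsP i.
  by move=> z zu; apply: Wv; rewrite WU UE zu.
set s := dot v (u i) in vE.
have cE : c = s * h i.
  by have := Fv _ Fy; have := Fi _ Fy; rewrite /= vE dotZl => -> <-.
have s0 : s != 0 by apply: contraNneq v0 => s0; rewrite vE s0 scale0r.
have [x0 x0lt] := fs_interior fsP.
have spos : 0 < s.
  have : dot v x0 <= c by apply: vle; apply/(fs_mem fsP) => j; rewrite ltW.
  rewrite cE vE dotZl lt_def s0 /= leNgt => H1; apply/negP => sneg.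
  by move: H1 (x0lt i); nra.
exists i, s; split=> //; rewrite FE; apply/seteqP.
split=> z [Pz /= zE]; split=> //=; move: zE; rewrite cE vE dotZl.
  by move=> /(mulfI s0).
by move=> ->.
Qed.

Lemma facet_cut i : is_face_cut P (u i) (h i) (P `&` H i).
Proof. by split=> // x /(fs_mem fsP). Qed.

Lemma facet_hyperplanesE : facet_hyperplanes P = hyperplanes u h.
Proof.
apply/seteqP; split=> A.
  move=> [F [[v [c vF]] [d [dP dF]]] <-].
  have [i [s [_ _ _ ->]]] := face_cut_facet vF dF dP.
  by exists i; rewrite aff_hull_facet.
move=> [i ->]; exists (P `&` H i); last exact: aff_hull_facet.
by split; [exists (u i), (h i); exact: facet_cut|exact: dim_facet].
Qed.

Lemma facet_normalsE : facet_normals P = range u.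
Proof.
apply/seteqP; split=> v /=.
  move=> [vv [c [F [[_ [d [dP dF]]] vF]]]].
  have [i [s [s0 vE _ _]]] := face_cut_facet vF dF dP.
  exists i => //; move: vv; rewrite vE dotZl dotZr (fs_unit fsP) mulr1 => /eqP.
  by rewrite -expr2 sqrf_eq1 => /orP[/eqP ->|/eqP s1];
    [rewrite scale1r|move: s0; rewrite s1 ltr0N1].
move=> [i _ <-]; split; first exact: fs_unit fsP i.
exists (h i), (P `&` H i); split; last exact: facet_cut.
by split; [exists (u i), (h i); exact: facet_cut|exact: dim_facet].
Qed.

End Facets.

(** * Polytopes as intersections of half-spaces *)

Section Weyl.
Variables (R : realType) (n : nat).
Local Notation V := 'rV[R]_n.
Local Notation E := (V * R^o)%type.
Implicit Types (c z v : E) (s cs : seq E).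

(** c encodes the affine inequality c.1 x + c.2 <= 0, homogenized. *)
Definition dual c z : R := dot c.1 z.1 + c.2 * z.2.

Lemma dualDr c z z' : dual c (z + z') = dual c z + dual c z'.
Proof. by rewrite /dual dotDr mulrDr addrACA. Qed.

Lemma dualZr c a z : dual c (a *: z) = a * dual c z.
Proof. by rewrite /dual dotZr mulrDr /= /GRing.scale /=; ring. Qed.

Lemma dualBr c z z' : dual c (z - z') = dual c z - dual c z'.
Proof. by rewrite -scaleN1r dualDr dualZr mulN1r. Qed.

Lemma dualBl c c' z : dual (c - c') z = dual c z - dual c' z.
Proof. by rewrite /dual dotBl /= mulrBl; ring. Qed.

Lemma dualZl a c z : dual (a *: c) z = a * dual c z.
Proof. by rewrite /dual dotZl /= /GRing.scale /=; ring. Qed.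

Fixpoint in_cone s z : Prop :=
  if s is v :: s' then exists2 t, 0 <= t & in_cone s' (z - t *: v) else z = 0.

Lemma exists_max (x : R) (r : seq R) :
  exists2 m, m \in x :: r & forall y, y \in x :: r -> y <= m.
Proof.
elim: r x => [|y r IHr] x.
  by exists x; rewrite ?mem_seq1 // => y; rewrite mem_seq1 => /eqP ->.
have [m mr mmax] := IHr y; have [xm|mx] := leP x m.
  by exists m => [|z]; rewrite inE ?mr ?orbT // => /orP[/eqP ->|/mmax].
exists x => [|z]; rewrite inE ?eqxx // => /orP[/eqP -> //|/mmax zm].
exact: le_trans zm (ltW mx).
Qed.

(* Fourier-Motzkin elimination of the coefficient of each generator. *)
Lemma in_cone_dual s : exists cs, forall z,
  in_cone s z <-> forall c, c \in cs -> dual c z <= 0.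
Proof.
elim: s => [|v s [cs csP]].
  pose pm : seq R := [:: 1; -1].
  exists ([seq (a *: (delta_mx 0 i : V), 0 : R^o) | a <- pm, i <- enum 'I_n]
    ++ [:: (0, 1); (0, -1)]) => z /=; split=> [-> c _|zle].
    by rewrite /dual /= dot0r mulr0 addr0.
  have z2 : z.2 = 0.
    have := zle (0, 1); rewrite mem_cat !inE eqxx orbT /dual dot0l => /(_ isT)
      H1.
    have := zle (0, -1); rewrite mem_cat !inE eqxx !orbT /dual dot0l => /(_ isT)
      /= H2.
    by move: H1 H2 => /=; lra.
  have z1 i a : a \in pm -> a * z.1 0 i <= 0.
    move=> ai; have : dual (a *: (delta_mx 0 i : V), 0 : R^o) z <= 0.
      apply: zle; rewrite mem_cat; apply/orP; left.
      by rewrite cats0 mem_cat; move: ai; rewrite !inE => /orP[]/eqP ->;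
        apply/orP; [left|right]; apply/mapP; exists i; rewrite ?mem_enum.
    rewrite /dual /= mul0r addr0 dotZl; congr (_ * _ <= 0).
    rewrite /dot (bigD1 i) //= mxE !eqxx mul1r big1 ?addr0 // => j ji.
    by rewrite mxE eqxx (negPf ji) mul0r.
  case: z z2 z1 {zle} => z z' /= -> z1; congr pair; apply/rowP => i;
    rewrite mxE.
  have := z1 i 1; have := z1 i (-1); rewrite !inE !eqxx orbT => /(_ isT)
    H1 /(_ isT) H2.
  by lra.
pose pos := [seq c <- cs | 0 < dual c v]; pose neg := [seq c <- cs | dual c v <
  0].
exists ([seq c <- cs | dual c v <= 0]
  ++ [seq dual p v *: q - dual q v *: p | p <- pos, q <- neg]) => z /=.
split=> [[t t0 /csP zt] c|zle].
  have zle d : d \in cs -> dual d z <= t * dual d v.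
    by move=> /zt; rewrite dualBr dualZr subr_le0.
  rewrite mem_cat mem_filter => /orP[/andP[cv /zle]|].
    by move=> /le_trans; apply; rewrite mulr_ge0_le0.
  move=> /allpairsPdep[p [q []]]; rewrite !mem_filter => /andP[pv pcs]
    /andP[qv qcs] ->.
  rewrite dualBl !dualZl; have := zle p pcs; have := zle q qcs.
  set a := dual p v in pv *; set b := dual q v in qv * => Hq Hp; nra.
have zpair p q : p \in cs -> q \in cs -> 0 < dual p v -> dual q v < 0 ->
    dual p v * dual q z <= dual q v * dual p z.
  move=> pcs qcs pv qv; rewrite -subr_le0 -!dualZl -dualBl; apply: zle.
  rewrite mem_cat; apply/orP; right; apply/allpairsPdep; exists p, q.
  by rewrite !mem_filter /= pv qv.
(* t is the largest of its lower bounds, 0 included; the paired inequalities put it below every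
   upper bound. *)
have [t tr tmax] := exists_max 0 [seq dual p z / dual p v | p <- pos].
exists t; first by apply: tmax; rewrite mem_head.
apply/csP => c ccs; rewrite dualBr dualZr subr_le0.
case: (ltrgtP (dual c v) 0) => [cv|cv|cv].
- rewrite -ler_ndivlMr //; move: tr; rewrite inE => /orP[/eqP ->|/mapP[p]].
    rewrite ler_ndivlMr // mul0r; apply: zle.
    by rewrite mem_cat mem_filter ccs ltW.
  rewrite mem_filter => /andP[pv pcs] ->.
  rewrite ler_ndivlMr // mulrAC ler_pdivlMr // mulrC [leRHS]mulrC.
  exact: zpair.
- rewrite -ler_pdivrMr //; apply: tmax; rewrite inE; apply/orP; right.
  by apply/mapP; exists c => //; rewrite mem_filter cv.
- by rewrite cv mulr0; apply: zle; rewrite mem_cat mem_filter ccs cv lexx.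
Qed.

Lemma in_cone0 s : in_cone s 0.
Proof. by elim: s => //= v s IHs; exists 0; rewrite // scale0r subr0. Qed.

Lemma in_cone_mem s v : v \in s -> in_cone s v.
Proof.
elim: s => // w s IHs; rewrite inE => /orP[/eqP ->|/IHs vs].
  by exists 1; rewrite // scale1r subrr; exact: in_cone0.
by exists 0; rewrite // scale0r subr0.
Qed.

End Weyl.

Section Polytope.
Variables (R : realType) (n : nat).
Local Notation V := 'rV[R]_n.
Local Notation E := (V * R^o)%type.
Implicit Types (A : set V) (P : set V).

Lemma convex_setP A : @convex_set R V A <->
  forall x y (t : R), A x -> A y -> 0 <= t -> t <= 1 -> A (t *: x + (1 - t)
    *: y).
Proof.
split=> [cA x y t Ax Ay t0 t1|cA x y l].
  have := cA x y (Itv01 t0 t1); rewrite !inE; exact.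
by rewrite !inE => Ax Ay; apply: cA.
Qed.

Lemma sub_conv_hull A : A `<=` conv_hull A.
Proof. exact: sub_smallest. Qed.

Lemma conv_hull_le A w c : (forall x, A x -> dot w x <= c) ->
  forall x, conv_hull A x -> dot w x <= c.
Proof.
move=> Aw; apply: (@smallest_sub _ _ _ [set x | dot w x <= c]); last exact: Aw.
apply/convex_setP => x y t /= xc yc t0 t1; rewrite dotDr !dotZr.
by nra.
Qed.

Lemma in_cone_convex (s : seq V) A (z : E) : @convex_set R V A ->
    (forall v, v \in s -> A v) -> in_cone [seq (v, 1 : R^o) | v <- s] z ->
  z = 0 \/ (0 < z.2 /\ A (z.2^-1 *: z.1)).
Proof.
move=> /convex_setP cA; elim: s z => [|v s IHs] z sA /=; first by left.
move=> [t]; rewrite le_eqVlt => /orP[/eqP <-|t0].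
  by rewrite scale0r subr0; apply: IHs => w ws; apply: sA; rewrite inE ws orbT.
have Av : A v by apply: sA; rewrite mem_head.
move=> /IHs[w ws||[]]; first by apply: sA; rewrite inE ws orbT.
  move=> /eqP; rewrite subr_eq0 => /eqP zE; right.
  have [-> ->] : z.1 = t *: v /\ z.2 = t by rewrite zE; split=> //=;
    exact: mulr1.
  by rewrite scalerA mulVf ?scale1r // gt_eqF.
case: z => x r /=; have -> : r - t *: (1 : R^o) = r - t by congr (_ - _);
  exact: mulr1.
move=> rt Axr; right.
have r0 : 0 < r by lra.
split=> //.
(* The heights r - t and t of the two summands become the convex weights. *)
have -> : r^-1 *: x = ((r - t) / r) *: ((r - t)^-1 *: (x - t *: v))
  + (1 - (r - t) / r) *: v.
  rewrite scalerA mulrAC divff ?gt_eqF // mul1r scalerBr scalerA -addrA -scaleNr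
    -scalerDl.
  have -> : - (r^-1 * t) + (1 - (r - t) / r) = 0 by field; rewrite gt_eqF.
  by rewrite scale0r addr0.
apply: cA => //; first by rewrite divr_ge0 // ltW.
by rewrite ler_pdivrMr // mul1r gerBl ltW.
Qed.

(** Lift the points to height 1 and cut the cone over them, described by [in_cone_dual], at that
    height. *)
Lemma conv_hull_halfspaces (s : seq V) : exists cs : seq E, forall x,
  conv_hull [set` s] x <-> forall c, c \in cs -> dot c.1 x <= - c.2.
Proof.
have [cs csP] := in_cone_dual [seq (v, 1 : R^o) | v <- s].
have dualE c x : (dual c (x, 1) <= 0) = (dot c.1 x <= - c.2).
  by rewrite /dual /= mulr1 -[RHS]subr_le0 opprK.
exists cs => x; split=> [|xcs].
  apply: (@smallest_sub _ _ _ [set x | forall c, c \in cs ->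
    dot c.1 x <= - c.2]).
    apply/convex_setP => y z t /= yc zc t0 t1 c ccs; rewrite dotDr !dotZr.
    by move: (yc c ccs) (zc c ccs); nra.
  move=> v /= vs c ccs; rewrite -dualE; move: c ccs; apply/csP.
  by apply: in_cone_mem; exact: (map_f (fun v => (v, 1 : R^o))).
move=> C [cC sC]; have : in_cone [seq (v, 1 : R^o) | v <- s] (x, 1).
  by apply/csP => c /xcs; rewrite dualE.
move=> /(in_cone_convex cC)[v vs|/(congr1 snd)/= /eqP|[_]]; first exact: sC.
  by rewrite oner_eq0.
by rewrite /= invr1 scale1r.
Qed.

End Polytope.

(** * Facet systems of full-dimensional polytopes *)

Section Existence.
Variables (R : realType) (n : nat).
Local Notation V := 'rV[R]_n.
Implicit Types (P Q : set V).

Lemma polytope_max P w : polytope P ->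
  exists2 x, P x & forall y, P y -> dot w y <= dot w x.
Proof.
move=> [S [/finite_seqP[s ->] [x0 /= x0s] ->]].
have [m ms mmax] : exists2 m, m \in s & forall y, y \in s -> dot w y <= dot w m.
  elim: s x0 x0s => // v s IHs _ _; case: s IHs => [_|v' s IHs].
    by exists v; rewrite ?mem_head // => y; rewrite mem_seq1 => /eqP ->.
  have [m ms mmax] := IHs v' (mem_head _ _); have [vm|mv] := leP (dot w v)
    (dot w m).
    by exists m => [|y]; rewrite inE ?ms ?orbT // => /orP[/eqP ->|/mmax].
  exists v => [|y]; rewrite inE ?eqxx // => /orP[/eqP -> //|/mmax ym].
  exact: le_trans ym (ltW mv).
by exists m; [exact: sub_conv_hull|exact: conv_hull_le].
Qed.

Lemma irredundant_subfamily (I : finType) (a : I -> V) (b : I -> R) P :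
    (forall x, P x <-> forall i, dot (a i) x <= b i) ->
  exists J : {set I},
    (forall x, P x <-> forall i, i \in J -> dot (a i) x <= b i) /\
    forall i, i \in J -> exists2 y, b i < dot (a i) y &
      forall j, j \in J -> j != i -> dot (a j) y <= b j.
Proof.
move=> Pab.
pose good (J : {set I}) := `[< forall x, P x <-> forall i, i \in J -> dot (a i)
  x <= b i >].
have goodT : good finset.setT.
  by apply/asboolP => x; rewrite Pab; split=> xP i //; exact: xP.
have [J /minsetP[/asboolP PJ minJ] _] := minset_exists (P := good) goodT.
exists J; split=> // i iJ; apply: contrapT => /forall2NP noy.
have : good (J :\ i).
  apply/asboolP => x; rewrite PJ; split=> xJ j.
    by rewrite finset.in_setD1 => /andP[_]; exact: xJ.
  move=> jJ; have [->|ji] := eqVneq j i; last by apply: xJ;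
    rewrite finset.in_setD1 ji.
  rewrite leNgt; apply/negP => xi; have [/(_ xi)//|] := noy x; apply=> l lJ li.
  by apply: xJ; rewrite finset.in_setD1 li.
move=> /minJ/(_ (subsetDl _ _)) JE.
by move: iJ; rewrite -JE finset.in_setD1 eqxx.
Qed.

(** Full dimension yields an interior point x0 by averaging. The segment from x0 to a point
    violating only constraint i crosses its hyperplane where all other constraints are strict. *)
Lemma facet_system_of_irredundant (I : finType) (a : I -> V) (b : I -> R) P :
    polytope P -> aff_hull P = setT ->
    (forall x, P x <-> forall i, dot (a i) x <= b i) ->
    (forall i, exists2 y, b i < dot (a i) y &
       forall j, j != i -> dot (a j) y <= b j) ->
  exists u h, @facet_system R n I P u h.
Proof.
move=> polP affP Pab irr.
have [p Pp] : exists p, P p by have /aff_hull_neq0 : aff_hull P 0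
  by rewrite affP.
have a0 i : a i != 0.
  apply/eqP => ai; have [y yi _] := irr i; move: yi; have := (Pab p).1 Pp i.
  by rewrite ai !dot0l leNgt => /negP.
have [x0 x0lt] : exists x, forall i, dot (a i) x < b i.
  have /choice[z zP] : forall i, exists z, P z /\ dot (a i) z < b i.
    move=> i; apply: contrapT => /forallNP noz.
    have /aff_hull_sub aff : P `<=` [set y | dot (a i) y = b i].
      move=> z Pz /=; apply/eqP; rewrite eq_le (Pab z).1 //= leNgt.
      by apply/negP => zi; apply: (noz z).
    have bi : b i = 0 by have := aff 0; rewrite affP /= dot0r => /(_ Logic.I)
      ->.
    have := aff (a i); rewrite affP /= bi => /(_ Logic.I)/eqP.
    by rewrite dot_eq0 (negPf (a0 i)).
  have [i|i j|i|x xlt _] := @average_strict R n I a b p z; last by exists x.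
  - exact: (Pab p).1.
  - by apply: (Pab (z j)).1; have [] := zP j.
  - by have [] := zP i.
pose r i := Num.sqrt (dot (a i) (a i)).
have r0 i : 0 < r i by rewrite sqrtr_gt0 dot_gt0.
exists (fun i => (r i)^-1 *: a i), (fun i => (r i)^-1 * b i).
have leE i x : (dot ((r i)^-1 *: a i) x <= (r i)^-1 * b i) = (dot (a i)
  x <= b i).
  by rewrite dotZl ler_pM2l // invr_gt0.
have ltE i x : (dot ((r i)^-1 *: a i) x < (r i)^-1 * b i) = (dot (a i) x < b i).
  by rewrite dotZl ltr_pM2l // invr_gt0.
split.
- by move=> x; rewrite Pab; split=> xP i; move: (xP i); rewrite leE.
- move=> i; rewrite dotZl dotZr -[dot (a i) (a i)]sqr_sqrtr ?dot_ge0 // -/(r i).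
  by field; rewrite gt_eqF.
- by exists x0 => i; rewrite ltE.
- move=> i; have [y yi yj] := irr i.
  have lt := x0lt i; set alpha := dot (a i) x0 in lt;
    set beta := dot (a i) y in yi.
  have ab : 0 < beta - alpha by rewrite subr_gt0 (lt_trans lt).
  pose t := (b i - alpha) / (beta - alpha).
  have t0 : 0 < t by rewrite divr_gt0 // subr_gt0.
  have t1 : t < 1 by rewrite ltr_pdivrMr // mul1r ltrD2r.
  have tE : t * (beta - alpha) = b i - alpha by rewrite divfK // gt_eqF.
  exists (x0 + t *: (y - x0)).
    rewrite dotZl dotDr dotZr dotBr -/alpha -/beta tE; congr (_ * _); ring.
  move=> j ji; rewrite ltE dotDr dotZr dotBr.
  by move: (x0lt j) (yj j ji); nra.
- by move=> w; exact: polytope_max.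
Qed.

Lemma polytope_facet_system P : polytope P -> has_dim P n ->
  exists (I : finType) (u : I -> V) h, facet_system P u h.
Proof.
move=> polP /has_dim_full affP; have [S [/finite_seqP[s SE] _ PE]] := polP.
have [cs csP] := conv_hull_halfspaces s.
have P_cs x : P x <-> forall i : 'I_(size cs), dot (tnth (in_tuple cs)
  i).1 x <= - (tnth (in_tuple cs) i).2.
  rewrite PE SE csP; split=> xcs i; first by apply: xcs; exact: mem_tnth.
  by move=> ics; have [j ->] := tnthP (in_tuple cs) i ics; exact: xcs.
have [J [PJ irrJ]] := irredundant_subfamily P_cs.
pose I : finType := {i | i \in J}.
exists I; apply: (facet_system_of_irredundant polP affP).
  move=> x; rewrite PJ; split=> [xJ i|xI i iJ]; first by apply: xJ;
    exact: (valP i).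
  exact: (xI (exist _ i iJ)).
move=> i; have [y yi yj] := irrJ _ (valP i); exists y => // j ji.
by apply: yj; [exact: (valP j)|rewrite (inj_eq val_inj)].
Qed.

Lemma orthogonal_exists (W : {vspace V}) : W != fullv ->
  exists2 w, w != 0 & forall y, y \in W -> dot w y = 0.
Proof.
move=> WN; have [v vW] : exists v, v \notin W.
  apply: contrapT => /forallNP noV; move: WN; rewrite eqEsubv subvf /=.
  by move=> /subvP; apply=> v _; have /negP := noV v; rewrite negbK.
pose b (i : 'I_(\dim W)) := (vbasis W)`_i.
have combW d : comb b d \in W.
  by apply: memv_suml => i _; apply/memvZ/vbasis_mem/mem_nth;
    rewrite size_tuple.
have [d _ dv|w bw wv] := @off_span R n _ b finset.setT v.
  by move: vW; rewrite -dv combW.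
exists w; first by apply: contraTneq wv => ->; rewrite dot0r ltxx.
move=> y /coord_vbasis ->; rewrite dot_sumr big1 // => i _.
by rewrite dotZr dotC bw ?mulr0.
Qed.

End Existence.

(** * Polytopes with the same facet normals *)

Lemma facet_system_inj (R : realType) (n : nat) (I : finType)
  (P : set 'rV[R]_n) (u : I -> 'rV[R]_n) (h : I -> R) : facet_system P u h ->
    injective u.
Proof.
move=> fsP.
have lt i j : i != j -> u i = u j -> h i < h j.
  move=> ij uij; have [z zi zlt] := fs_facet fsP i.
  by rewrite -zi uij zlt // eq_sym.
move=> i j uij; apply/eqP; apply: contraT => ij.
have ji : j != i by rewrite eq_sym.
by have := lt_trans (lt i j ij uij) (lt j i ji (esym uij)); rewrite ltxx.
Qed.

Section SameNormals.
Variables (R : realType) (n : nat) (I : finType).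
Local Notation V := 'rV[R]_n.
Variables (P : set V) (u : I -> V) (h : I -> R).
Hypothesis fsP : facet_system P u h.

(* The facets of a polytope of dimension < n have infinitely many unit        *)
(* normals: tilt one by any vector orthogonal to the affine hull.             *)
Lemma same_normals_full_dim (Q : set V) : has_dim P n -> polytope Q ->
  facet_normals Q = facet_normals P -> has_dim Q n.
Proof.
move=> dimP polQ; rewrite (facet_normalsE fsP dimP) => NQ.
(* Without facets P is the whole space, where forms have maxima only if every vector is 0. *)
have [I0|[i0]] : (forall i : I, False) \/ inhabited I.
  by have [[i _]|noI] := pselect (exists i : I, True); [right|left=> i;
    apply: noI; exists i].
  have V0 (x : V) : x = 0.
    have [p Pp pmax] := fs_max fsP x; apply/eqP;
      rewrite -dot_eq0 eq_le dot_ge0 andbT.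
    have := pmax (x + p); rewrite dotDr gerDr; apply.
    by apply/(fs_mem fsP) => i; case: (I0 i).
  apply/has_dim_full/seteqP; split=> // x _; have [y Qy _]
    := polytope_max 0 polQ.
  by rewrite (V0 x) -(V0 y); exact: sub_aff_hull.
have : facet_normals Q (u i0) by rewrite NQ; exists i0.
move=> [_ [c [F [[_ [d [dQ dF]]] [cle FE]]]]].
have [x [W [dW QW]]] := dQ.
suff WT : W = fullv.
  apply/has_dim_full; rewrite QW WT; apply/seteqP; split=> // y _ /=.
  by rewrite memvf.
apply/eqP; apply: contraT => WN.
have [w w0 wW] := orthogonal_exists WN.
have Qw y : Q y -> dot w y = dot w x.
  move=> /sub_aff_hull; rewrite QW /= => /wW /eqP.
  by rewrite dotBr subr_eq0 => /eqP.
have [f Ff] : exists f, F f.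
  have [x' [W' [_ FW']]] := dF.
  by apply: (@aff_hull_neq0 _ _ F x'); rewrite FW' /= subrr mem0v.
have uN t : u i0 <> t *: w.
  move=> ut; suff FQ : F = Q.
    by move: dF; rewrite FQ => dQ'; have /n_Sn := has_dim_inj dQ' dQ.
  rewrite FE; apply/seteqP; split=> [z []//|z Qz]; split=> //=.
  have : dot (u i0) f = c by move: Ff; rewrite FE => -[].
  have Qf : Q f by move: Ff; rewrite FE => -[].
  by rewrite ut !dotZl !Qw.
pose v (k : nat) := u i0 + k%:R *: w.
have v0 k : v k != 0.
  apply/eqP => /eqP; rewrite addr_eq0 -scaleNr => /eqP; exact: uN.
pose r k := Num.sqrt (dot (v k) (v k)).
have r0 k : 0 < r k by rewrite sqrtr_gt0 dot_gt0.
have /choice[g gP] : forall k, exists i, u i = (r k)^-1 *: v k.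
  move=> k; suff : facet_normals Q ((r k)^-1 *: v k) by rewrite NQ => -[i _ <-];
    exists i.
  split.
    rewrite dotZl dotZr -[dot (v k) (v k)]sqr_sqrtr ?dot_ge0 // -/(r k).
    by field; rewrite gt_eqF.
  exists ((r k)^-1 * (c + k%:R * dot w x)), F.
  have vE y : Q y -> dot (v k) y = dot (u i0) y + k%:R * dot w x.
    by move=> Qy; rewrite dotDl dotZl Qw.
  split; first by split; [exists (u i0), c|exists d].
  split=> [y Qy|].
    by rewrite dotZl ler_pM2l ?invr_gt0 // vE // lerD2r; exact: cle.
  rewrite FE; apply/seteqP; split=> y [Qy /= yE]; split=> //=.
    by rewrite dotZl vE // yE.
  apply: (@addIr _ (k%:R * dot w x)); apply: (@mulfI _ (r k)^-1).
    by rewrite gt_eqF // invr_gt0.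
  by rewrite -yE dotZl vE.
(* As u i0 is not a multiple of w, distinct tilts have distinct directions; infinitely many normals
   would then be indexed by the finite I. *)
have ginj : injective g.
  move=> k l gkl; have := gP k; rewrite gkl gP.
  have := r0 k; rewrite -invr_gt0; have := r0 l; rewrite -invr_gt0.
  move: (r k)^-1 (r l)^-1 => al be be0 al0 E.
  have E' : (al - be) *: u i0 = (be * l%:R - al * k%:R) *: w.
    move/eqP: E; rewrite /v !scalerDr !scalerA scalerBl [RHS]scalerBl => /eqP E.
    apply/eqP; rewrite subr_eq addrAC eq_sym subr_eq addrC -E.
    by rewrite addrC.
  have [ab|ab] := eqVneq al be; last first.
    case: (uN ((al - be)^-1 * (be * l%:R - al * k%:R))).
    by rewrite -scalerA -E' scalerA mulVf ?scale1r // subr_eq0.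
  move: E'; rewrite ab subrr scale0r -mulrBr => /esym/eqP.
  rewrite scaler_eq0 (negPf w0) orbF mulf_eq0 gt_eqF //= subr_eq0 eqr_nat.
  by move=> /eqP.
have /leq_card : injective (fun j : 'I_#|I|.+1 => g j)
  by move=> j l /ginj/val_inj.
by rewrite card_ord ltnn.
Qed.

(** A facet system of Q has the same set of normals, without repetition, so it can be reindexed by
    I. *)
Lemma facet_system_transfer (Q : set V) : has_dim P n -> polytope Q ->
  facet_normals Q = facet_normals P -> exists h', facet_system Q u h'.
Proof.
move=> dimP polQ NQ; have dimQ := same_normals_full_dim dimP polQ NQ.
have [I' [u' [h' fsQ]]] := polytope_facet_system polQ dimQ.
move: NQ; rewrite (facet_normalsE fsP dimP) (facet_normalsE fsQ dimQ) => NQ.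
have /choice[g gP] : forall i, exists j, u' j = u i.
  move=> i; have : range u' (u i) by rewrite NQ; exists i.
  by move=> [j _ <-]; exists j.
have u'inj := facet_system_inj fsQ.
have ginj : injective g.
  by move=> i j gij; apply: (facet_system_inj fsP); rewrite -!gP gij.
exists (h' \o g); split=> [x|i||i|w].
- split=> [Qx i|xle]; first by rewrite -gP; exact: P_le fsQ _ _ Qx.
  apply/(fs_mem fsQ) => j; have : range u (u' j) by rewrite -NQ; exists j.
  by move=> [i _]; rewrite -gP => /u'inj <-; rewrite gP; exact: xle.
- exact: fs_unit fsP i.
- by have [x xlt] := fs_interior fsQ; exists x => i; rewrite -gP; exact: xlt.
- have [z zi zlt] := fs_facet fsQ (g i); exists z; rewrite -?gP // => j ji.
  by rewrite -gP; apply: zlt; rewrite (inj_eq ginj).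
- exact: fs_max fsQ w.
Qed.

End SameNormals.

Theorem theorem2 (R : realType) (n : nat) (P : set 'rV[R]_n)
    (hP : polytope P) (hdim : has_dim P n)
    (hmono : monotypic P) (hnstrong : ~ strongly_monotypic P) :
  ~ generating_property P.
Proof.
move=> genP; apply: hnstrong => Q polQ NQ.
have [I [u [h fsP]]] := polytope_facet_system hP hdim.
have [h' fsQ] := facet_system_transfer fsP hdim polQ NQ.
have dimQ := same_normals_full_dim fsP hdim polQ NQ.
rewrite (facet_hyperplanesE fsP hdim) (facet_hyperplanesE fsQ dimQ).
have nobad := no_bad_circuit fsP genP.
(* Bad circuits depend on u alone, so their absence, derived from P, serves both directions. *)
by apply: cells_isomorphic => x; [exact: same_signs fsQ fsP nobad|exact:
  same_signs fsP fsQ nobad].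
Qed.
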